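(* Let $\Gamma$ be a finitely generated discrete torsion-free nilpotent group, with identity element $e$. Then there exists a positive, finitely additive measure $\mu$ on the unitary dual $\widehat{\Gamma}$ of $\Gamma$, supported by the set $\widehat{\Gamma}_{\rm fin}\subset\widehat{\Gamma}$ of equivalence classes of finite-dimensional irreducible unitary representations of $\Gamma$, such that for every $f\in L^1(\Gamma)$ the function $$\pi\mapsto \frac{1}{\dim\pi}\,{\rm Tr}(\pi(f))$$ is $\mu$-integrable on $\widehat{\Gamma}$, and $$f(e)=\int_{\widehat{\Gamma}_{\rm fin}}\frac{1}{\dim \pi}\,{\rm Tr}(\pi(f))\,d\mu(\pi).$$
   Context: $\widehat{\Gamma}$ is the set of unitary equivalence classes of irreducible unitary representations of $\Gamma$. For $f\in L^1(\Gamma)$ (absolutely summable functions on $\Gamma$) and a unitary representation $\pi$ of $\Gamma$, the Fourier transform is $\pi(f)=\sum_{\gamma\in\Gamma}f(\gamma)\pi(\gamma)$. The measure $\mu$ is only required to be finitely additive, and ''supported by $\widehat\Gamma_{\rm fin}$'' means that the complement of $\widehat\Gamma_{\rm fin}$ has measure zero. *)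

(* Defs.v *)
From HB Require Import structures.
From mathcomp Require Import all_boot all_order all_algebra.
From mathcomp Require Import complex.
From mathcomp Require Import all_classical all_reals all_analysis.
From mathcomp Require summability.

Set Implicit Arguments.
Unset Strict Implicit.
Unset Printing Implicit Defensive.

Import Order.TTheory GRing.Theory Num.Theory.
Import numFieldNormedType.Exports.

Local Open Scope classical_set_scope.
Local Open Scope ring_scope.
Local Open Scope complex_scope.

Section Groups.
Variable Gamma : groupType.
Implicit Types (A : set Gamma) (g : Gamma).
Local Open Scope group_scope.

Definition generated A : set Gamma :=
  smallest [set H : set Gamma | group_closed (mem H)] A.

Definition finitely_generated : Prop :=
  exists2 A, finite_set A & generated A = [set: Gamma].

Definition torsion_free : Prop :=
  forall g (n : nat), (0 < n)%N -> g ^+ n = 1 -> g = 1.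

Fixpoint lower_central (n : nat) : set Gamma :=
  if n is m.+1 then
    generated [set [~ x, y] | x in lower_central m & y in [set: Gamma]]
  else [set: Gamma].

Definition nilpotent_group : Prop := exists n, lower_central n = [set 1].

End Groups.
Arguments finitely_generated : clear implicits.
Arguments torsion_free : clear implicits.
Arguments nilpotent_group : clear implicits.

(* The inner product is linear in its first argument. *)
Record hilbertSpace (R : realType) := HilbertSpace {
  hilbert_sort :> completeNormedModType R[i];
  hdot : {dot hilbert_sort for @Num.conj R[i]};
  hdot_norm : forall v : hilbert_sort, hdot v v = `|v| ^+ 2 }.

Section Operators.
Variables (R : realType) (V : lmodType R[i]).

Definition has_dim (n : nat) : Prop := inhabited (Vector.axiom n V).

Definition finite_dim : Prop := exists n, has_dim n.

(* 0 when V is infinite-dimensional. *)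
Definition dimension : nat := xget 0%N has_dim.

(* The matrix A of T in the coordinates e acts on row vectors. *)
Definition is_trace (T : V -> V) (z : R[i]) : Prop :=
  exists n (e : Vector.axiom n V) (A : 'M[R[i]]_n),
    (forall v, sval e (T v) = sval e v *m A) /\ z = \tr A.

(* 0 when V is infinite-dimensional. *)
Definition trace (T : V -> V) : R[i] := xget 0 (is_trace T).

End Operators.

Section Representations.
Variables (R : realType) (Gamma : groupType).

Record unitary_rep := UnitaryRep {
  rep_space : hilbertSpace R;
  rep_op :> Gamma -> {linear rep_space -> rep_space};
  rep_op1 : forall v, rep_op 1%g v = v;
  rep_opM : forall g h v, rep_op (g * h)%g v = rep_op g (rep_op h v);
  rep_op_unitary : forall g u v,
    hdot rep_space (rep_op g u) (rep_op g v) = hdot rep_space u v }.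

Definition irreducible_rep (pi : unitary_rep) : Prop :=
  (exists v : rep_space pi, v != 0) /\
  forall W : set (rep_space pi),
    closed W -> submod_closed (mem W) ->
    (forall g v, W v -> W (pi g v)) ->
    W = [set 0] \/ W = setT.

Definition unitary_equiv (pi sigma : unitary_rep) : Prop :=
  exists U : {linear rep_space pi -> rep_space sigma},
    [/\ bijective U,
        forall u v, hdot (rep_space sigma) (U u) (U v)
                    = hdot (rep_space pi) u v
      & forall g v, U (pi g v) = sigma g (U v)].

(* unitary_rep quantifies over all Hilbert spaces, so it and unitary_dual live
   in a universe above those of the library's set and measurableType; their
   subsets are plain predicates. *)
Definition unitary_dual :=
  {c : unitary_rep -> Prop |
    exists2 pi, irreducible_rep pi & c = unitary_equiv pi}.

Definition unitary_dual_fin (c : unitary_dual) : Prop :=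
  exists2 pi, sval c pi & finite_dim (rep_space pi).

Definition L1 (f : Gamma -> R[i]) : Prop :=
  summable [set: Gamma] (fun g => (complex.Re `|f g|)%:E).

(* The sum is the limit of the net of finite partial sums in the space. *)
Definition fourier (f : Gamma -> R[i]) (pi : unitary_rep)
    (v : rep_space pi) : rep_space pi :=
  summability.sum (fun g => f g *: pi g v).

Definition normalized_trace (f : Gamma -> R[i]) (pi : unitary_rep) : R[i] :=
  (dimension (rep_space pi))%:R^-1 * trace (@fourier f pi).

(* normalized_trace is constant on each equivalence class; its value on a
   class of infinite-dimensional representations is 0. *)
Definition dual_trace (f : Gamma -> R[i]) (c : unitary_dual) : R[i] :=
  xget 0 [set z | exists2 pi, sval c pi & z = normalized_trace f pi].

End Representations.

(* The library's sintegral, integral and integrable, restated for an X in an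
   arbitrary universe and the algebra of all subsets of X, for which every
   function is measurable.  When mu is only finitely additive this is still the
   usual (Dunford-Schwartz) integral: if fa_integrable mu D F, then the
   truncations of F to {1/k < |F| <= k} converge to F in measure and in mean
   (by Chebyshev), and are uniform limits of simple functions. *)
Section FinitelyAdditive.
Variables (R : realType) (X : Type).
Implicit Types (mu : (X -> Prop) -> \bar R) (D : X -> Prop).
Local Open Scope ereal_scope.

Definition finitely_additive_measure mu : Prop :=
  [/\ mu (fun=> False) = 0,
      forall A, 0 <= mu A
    & forall A B, (forall x, ~ (A x /\ B x)) ->
        mu (fun x => A x \/ B x) = mu A + mu B].

Definition fa_simple (s : X -> R) : Prop :=
  finite_set [set z | exists x, s x = z].

Definition fa_sintegral mu (s : X -> R) : \bar R :=
  \sum_(z \in [set: R]) z%:E * mu (fun x => s x = z).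

Definition fa_nnintegral mu (g : X -> R) : \bar R :=
  ereal_sup [set y | exists s : X -> R,
    [/\ fa_simple s, forall x, (0 <= s x <= g x)%R & y = fa_sintegral mu s]].

Definition fa_restrict D (g : X -> R) : X -> R :=
  fun x => if `[< D x >] then g x else 0%R.

Definition fa_Rintegral mu D (g : X -> R) : R :=
  fine (fa_nnintegral mu ((fa_restrict D g)^\+)%R
        - fa_nnintegral mu ((fa_restrict D g)^\-)%R).

Definition fa_integrable mu D (F : X -> R[i]) : Prop :=
  fa_nnintegral mu (fa_restrict D (fun x => complex.Re `|F x|%R)) < +oo.

Definition fa_integral mu D (F : X -> R[i]) : R[i] :=
  (fa_Rintegral mu D (fun x => complex.Re (F x))
    +i* fa_Rintegral mu D (fun x => complex.Im (F x)))%C.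

End FinitelyAdditive.

(* Main.v *)
(* A finitely generated nilpotent group is residually finite: if N is a maximal
   normal subgroup avoiding g <> 1, then every iterated commutator of generators
   has finite order modulo N, so Gamma / N is finite.  Given a finite set S,
   choose N of finite index meeting S at most in 1.  The permutation
   representation on Gamma / N has normalized character 1_N and is a direct sum
   of irreducible unitary representations; weighting these by their dimensions
   gives a finitely supported probability E_S on the dual with
   E_S(tr pi(g) / dim pi) = 1_N(g), which is delta_1(g) for g in S.  For f in L^1
   the difference between E_S(tr pi(f) / dim pi) and f(1) is at most the l^1-mass
   of f outside S.  An ultralimit of the E_S over the finite sets S is a positive
   functional, whose values on indicators form the required measure. *)

Require Import Defs.
From HB Require Import structures.
From mathcomp Require Import all_boot all_order all_algebra.
From mathcomp Require Import finmap complex.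
From mathcomp Require Import all_classical all_reals all_analysis.
From mathcomp Require summability.
From mathcomp Require Import spectral.
From mathcomp Require Import zify ring lra.

Set Implicit Arguments.
Unset Strict Implicit.
Unset Printing Implicit Defensive.

Import Order.TTheory GRing.Theory Num.Theory.
Import numFieldNormedType.Exports.

Local Open Scope classical_set_scope.
Local Open Scope ring_scope.
Local Open Scope complex_scope.

(** * Normal subgroups, congruence and centrality modulo a normal subgroup *)

Section ResidualFiniteness.
Variable G : groupType.
Implicit Types (N H M : set G) (g a x y z : G).
Local Open Scope group_scope.

Definition is_normal N : Prop :=
  [/\ N 1, forall x y, N x -> N y -> N (x * y),
      forall x, N x -> N x^-1 & forall x y, N x -> N (x ^ y)].

Definition eqmod N x y : Prop := N (x^-1 * y).

(** Only finitely many cosets of [N] meet [H]. A finite labelling that separates cosets expresses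
    this without a quotient group; the labelling may take several values on one coset. *)
Definition finite_mod H N : Prop :=
  exists (T : finType) (f : G -> T),
    forall x y, H x -> H y -> f x = f y -> eqmod N x y.

Definition avoiding_maximal N g : Prop :=
  [/\ is_normal N, ~ N g &
      forall M, is_normal M -> N `<=` M -> (exists2 x, M x & ~ N x) -> M g].

Lemma generated_ind (A H : set G) :
  H 1 -> (forall x y, H x -> H y -> H (x * y)) -> (forall x, H x -> H x^-1) ->
  A `<=` H -> generated A `<=` H.
Proof.
move=> H1 HM HV AH; apply: smallest_sub => //=; split; first by rewrite inE.
by move=> x y; rewrite !inE => Hx Hy; apply/HM/HV.
Qed.

Lemma is_normal1 : is_normal [set 1].
Proof.
split=> //= [x y -> ->|x ->|x y ->]; first by rewrite mulg1.
  by rewrite invg1.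
by rewrite conj1g.
Qed.

Lemma is_normalI N M : is_normal N -> is_normal M -> is_normal (N `&` M).
Proof.
move=> [N1 NM NV NJ] [M1 MM MV MJ].
split=> [|x y [? ?] [? ?]|x [? ?]|x y [? ?]]; split.
- by [].
- by [].
- exact: NM.
- exact: MM.
- exact: NV.
- exact: MV.
- exact: NJ.
- exact: MJ.
Qed.

Lemma eqmodI N M x y : eqmod (N `&` M) x y <-> eqmod N x y /\ eqmod M x y.
Proof. by []. Qed.

Lemma finite_modI H N M :
  finite_mod H N -> finite_mod H M -> finite_mod H (N `&` M).
Proof.
move=> [T [f fP]] [U [h hP]]; exists (T * U)%type, (fun x => (f x, h x)).
by move=> x y Hx Hy [fxy hxy]; apply/eqmodI; split; [exact: fP|exact: hP].
Qed.

Section Congruence.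
Variables (N : set G) (nN : is_normal N).

Lemma normal1 : N 1. Proof. by case: nN. Qed.
Lemma normalM x y : N x -> N y -> N (x * y).
Proof. by case: nN => _ + _ _; apply. Qed.
Lemma normalV x : N x -> N x^-1. Proof. by case: nN => _ _ + _; apply. Qed.
Lemma normalJ x y : N x -> N (x ^ y). Proof. by case: nN => _ _ _; apply. Qed.
Lemma normalX x n : N x -> N (x ^+ n).
Proof.
move=> Nx; elim: n => [|n IHn]; first exact: normal1.
by rewrite expgS; apply: normalM.
Qed.

Lemma normalJE x y : N (x ^ y) <-> N x.
Proof.
by split=> [|/normalJ//]; rewrite -{2}(conjgK y x); apply: normalJ.
Qed.

Lemma eqmod_refl x : eqmod N x x.
Proof. by rewrite /eqmod mulVg; exact: normal1. Qed.

Lemma eqmod_sym x y : eqmod N x y -> eqmod N y x.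
Proof. by move=> /normalV; rewrite invgM invgK. Qed.

Lemma eqmod_trans x y z : eqmod N x y -> eqmod N y z -> eqmod N x z.
Proof. by move=> xy /(normalM xy); rewrite /eqmod !gnorm. Qed.

Lemma eqmodM x y x' y' :
  eqmod N x x' -> eqmod N y y' -> eqmod N (x * y) (x' * y').
Proof.
move=> /(normalJ y) xx' /(normalM xx').
by rewrite /eqmod conjgE !gnorm.
Qed.

Lemma eqmodMI x y z : eqmod N (x * z) (y * z) -> eqmod N x y.
Proof.
by rewrite -[X in _ -> X](normalJE _ z) /eqmod conjgE !gnorm.
Qed.

Lemma eqmodIM x y z : eqmod N (z * x) (z * y) -> eqmod N x y.
Proof. by rewrite /eqmod !gnorm. Qed.

Lemma eqmod_normal x y : eqmod N x y -> N x <-> N y.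
Proof.
move=> xy; split=> [Nx|Ny]; first by have := normalM Nx xy; rewrite mulVKg.
by have := normalM Ny (eqmod_sym xy); rewrite mulVKg.
Qed.

Lemma eqmod1 x : eqmod N 1 x <-> N x.
Proof. by rewrite /eqmod !gsimp. Qed.

Lemma commg_eqmod a y : N [~ a, y] <-> eqmod N (y * a) (a * y).
Proof. by rewrite /eqmod commgEl conjgE !gnorm. Qed.

Definition cent_mod a : set G := [set y | N [~ a, y]].

(** The elements commuting with [a] modulo [N] form a subgroup, so centrality of [a] modulo [N] can
    be tested on generators. *)
Lemma cent_mod_generated (A : set G) a :
  A `<=` cent_mod a -> generated A `<=` cent_mod a.
Proof.
apply: generated_ind => [|x y|x].
- by rewrite /cent_mod/= commg1; exact: normal1.
- rewrite /cent_mod/= !commg_eqmod => xa ya.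
  rewrite -mulgA; apply: eqmod_trans (eqmodM (eqmod_refl x) ya) _.
  by rewrite !mulgA; apply: eqmodM xa (eqmod_refl y).
- rewrite /cent_mod/= !commg_eqmod => xa.
  apply: eqmod_sym; apply: (@eqmodIM _ _ x); rewrite mulVKg.
  by apply: (@eqmodMI _ _ x); rewrite mulgA mulgVK.
Qed.

Lemma cent_modX a y n : cent_mod a y -> cent_mod (a ^+ n) y.
Proof.
rewrite /cent_mod/= => /commg_eqmod ya; apply/commg_eqmod.
elim: n => [|n IHn]; first by rewrite expg0 mulg1 mul1g; exact: eqmod_refl.
rewrite expgS -mulgA; apply: eqmod_trans (eqmodM (eqmod_refl a) IHn).
by rewrite !mulgA; apply: eqmodM => //; exact: eqmod_refl.
Qed.

Lemma eqmodX_torsion z i j : i != j -> eqmod N (z ^+ i) (z ^+ j) ->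
  exists2 m, (0 < m)%N & N (z ^+ m).
Proof.
wlog lt_ij : i j / (i < j)%N => [th|].
  by case: (ltngtP i j) => // ij _ /[dup] /eqmod_sym; eauto using ltn_eqF, negbT.
move=> _; rewrite -(subnK (ltnW lt_ij)) => zij; exists (j - i)%N.
  by rewrite subn_gt0.
apply/eqmod1; apply: (@eqmodMI _ _ (z ^+ i)).
by rewrite mul1g -expgnDr.
Qed.

Section Central.
Variables (z : G) (zc : forall y, cent_mod z y).

(** The set is the preimage of the cyclic subgroup generated by the image of [z] modulo [N]. Two
    natural exponents stand for one integer exponent, so that inversion merely exchanges [p] and
    [q]. *)
Lemma is_normal_central :
  is_normal [set x | exists p q, eqmod N (x * z ^+ p) (z ^+ q)].
Proof.
have zXc y p : eqmod N (y * z ^+ p) (z ^+ p * y).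
  exact/commg_eqmod/cent_modX/zc.
split=> [|x y [p [q xpq]] [r [s yrs]]|x [p [q xpq]]|x y [p [q xpq]]] /=.
- by exists 0%N, 0%N; rewrite !expg0 mulg1; exact: eqmod_refl.
- exists (p + r)%N, (q + s)%N; rewrite !expgnDr.
  apply: eqmod_trans (eqmodM xpq yrs); rewrite -!mulgA.
  apply: eqmodM; first exact: eqmod_refl.
  by rewrite !mulgA; apply: eqmodM; [exact: zXc|exact: eqmod_refl].
- exists q, p; apply: eqmod_sym.
  apply: (@eqmodIM _ _ x); rewrite mulVKg.
  exact: xpq.
- exists p, q; rewrite conjgE; apply: (@eqmodIM _ _ y).
  rewrite !mulgA mulgV mul1g.
  apply: eqmod_trans (eqmod_sym (zXc y q)).
  rewrite -mulgA; apply: eqmod_trans (eqmodM xpq (eqmod_refl y)).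
  by rewrite -mulgA; apply: eqmodM; [exact: eqmod_refl|exact: zXc].
Qed.

End Central.

End Congruence.

(* [N <z^k>] is normal for every [k > 0]; if it is larger than [N] it contains
   [g], so [g] is congruent both to some [z^j] and to a power of [z^(2|j|)]. *)
Lemma central_torsion N g z : avoiding_maximal N g ->
  (forall y, cent_mod N z y) -> exists2 m, (0 < m)%N & N (z ^+ m).
Proof.
move=> [nN Ng maxN] zc; apply/not_exists2P => ntor.
have key m : (0 < m)%N ->
    exists p q, eqmod N (g * z ^+ (m * p)) (z ^+ (m * q)).
  move=> m0; have wc y : cent_mod N (z ^+ m) y by exact: cent_modX.
  have [||p [q]] := maxN _ (is_normal_central nN wc).
  - move=> x Nx; exists 0%N, 0%N; rewrite !expg0 mulg1.
    by apply: eqmod_sym => //; apply/eqmod1.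
  - exists (z ^+ m); last by move=> Nz; have [] := ntor m.
    by exists 0%N, 1%N; rewrite expg0 expg1 mulg1; exact: eqmod_refl.
  - by rewrite -!expgnA; exists p, q.
have [p [q]] := key 1%N isT; rewrite !mul1n => gpq.
have neq_pq : p != q.
  apply: contra_notN Ng => /eqP pq; rewrite -pq -{2}(mul1g (z ^+ p)) in gpq.
  by have /(eqmodMI nN)/eqmod_sym := gpq; move=> /(_ nN)/eqmod1.
pose d := (p - q + (q - p))%N.
have d0 : (0 < d)%N by rewrite /d; lia.
have [|p' [q' gpq']] := key (2 * d)%N; first by rewrite muln_gt0.
have : eqmod N (z ^+ (q + 2 * d * p')) (z ^+ (p + 2 * d * q')).
  rewrite !expgnDr.
  apply: (eqmod_trans nN).
    exact: (eqmodM nN (eqmod_sym nN gpq) (eqmod_refl nN _)).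
  have zC (k l : nat) : z ^+ k * z ^+ l = z ^+ l * z ^+ k by rewrite -!expgnDr addnC.
  rewrite -mulgA zC mulgA [X in eqmod N _ X]zC.
  exact: (eqmodM nN gpq' (eqmod_refl nN _)).
move/(eqmodX_torsion nN) => [|m m0 Nm]; last by have [] := ntor m.
(* The exponents differ: equality would make [p - q] a multiple of [2 * d], whereas its absolute
   value is [d > 0]. *)
have [->|p'q'] := eqVneq p' q'; first by lia.
by apply/eqP; rewrite /d; nia.
Qed.

End ResidualFiniteness.

(** * Residual finiteness of finitely generated nilpotent groups *)

Section NilpotentResidualFiniteness.
Variable G : groupType.
Implicit Types (N H M : set G) (g a x y z : G) (s : seq G).
Local Open Scope group_scope.

(* Pigeonhole on [k |-> ([~ a ^+ k, x] mod N)_(x in s)]: two equal values make a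
   positive power of [a] central modulo [N]. *)
Lemma commg_torsion N H g s a : avoiding_maximal N g -> is_normal H ->
  finite_mod H N -> generated [set` s] = [set: G] ->
  (forall x, x \in s -> H [~ a, x]) -> exists2 m, (0 < m)%N & N (a ^+ m).
Proof.
move=> maxN nH [T [f fP]] sG Has; have nN : is_normal N by case: maxN.
have Ha y : cent_mod H a y.
  have : generated [set` s] y by rewrite sG.
  by apply: cent_mod_generated => // x /=; exact: Has.
pose F (k : nat) := [ffun x : seq_sub s => f [~ a ^+ k, ssval x]].
have [k [l [kl Fkl]]] : exists k l, (k < l)%N /\ F k = F l.
  have /injectivePn[k [l kl Fkl]] :
      ~~ injectiveb (fun k : 'I_(#|{ffun seq_sub s -> T}|.+1) => F k).
    by apply/negP => /injectiveP/leq_card; rewrite card_ord ltnn.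
  case: (ltngtP k l) => [lt|lt|/val_inj kl0]; first by exists k, l.
    by exists l, k.
  by rewrite kl0 eqxx in kl.
have zc x : x \in s -> N [~ a ^+ (l - k), x].
  move=> xs; have /ffunP/(_ (SeqSub xs)) := Fkl; rewrite !ffunE /=.
  move=> /fP -/(_ (cent_modX nH _ (Ha x)) (cent_modX nH _ (Ha x))).
  rewrite -[in a ^+ l](subnK (ltnW kl)) expgnDr.
  set z := a ^+ (l - k) => Nz.
  apply/commg_eqmod/(eqmod_sym nN).
  (* Both [z * x * a^k * [a^k, x]] and [x * z * a^k * [z * a^k, x]] equal [z * a^k * x]; the two
     commutators are congruent, so cancelling leaves [z * x] congruent to [x * z]. *)
  apply: (@eqmodMI _ _ nN _ _ (a ^+ k * [~ a ^+ k, x])).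
  have -> : z * x * (a ^+ k * [~ a ^+ k, x]) =
      x * (z * a ^+ k) * [~ z * a ^+ k, x].
    by rewrite -commgC -!mulgA (mulgA x) -commgC.
  move: [~ a ^+ k, x] [~ z * a ^+ k, x] Nz => c d Nz.
  by rewrite !mulgA; exact: (eqmodM nN (eqmod_refl nN _) (eqmod_sym nN Nz)).
have zcT y : cent_mod N (a ^+ (l - k)) y.
  have : generated [set` s] y by rewrite sG.
  by apply: cent_mod_generated => // x /=; exact: zc.
have [m m0 Nm] := central_torsion maxN zcT.
by exists ((l - k) * m)%N; rewrite ?expgnA // muln_gt0 subn_gt0 kl.
Qed.

(** The extension is the product of [H] with the powers of [a], a normal subgroup because [a] is
    central modulo [H]. As [a^m] lies in [N], there are at most [m] cosets of [H] in it, and natural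
    exponents suffice. *)
Lemma cyclic_extension N H a m : is_normal N -> is_normal H -> N `<=` H ->
  finite_mod H N -> (forall y, cent_mod H a y) -> (0 < m)%N -> N (a ^+ m) ->
  exists H', [/\ is_normal H', H `<=` H', H' a & finite_mod H' N].
Proof.
move=> nN nH NH [T [f fP]] Ha m0 Nam; exists [set x | exists k, H (x * a ^+ k)].
have aC k y : eqmod H (y * a ^+ k) (a ^+ k * y).
  by apply/commg_eqmod; exact: (cent_modX nH _ (Ha y)).
have conjH x k : H (a ^+ k * x) <-> H (x * a ^+ k).
  by rewrite -(normalJE nH (a ^+ k * x) (a ^+ k)) conjgE !gnorm.
split=> [|x Hx||].
- split=> [|x y [k xk] [l yl]|x [k xk]|x y [k xk]] /=.
  + by exists 0%N; rewrite mulg1; exact: normal1.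
  + exists (k + l)%N.
    apply/(eqmod_normal nH (y := x * a ^+ k * (y * a ^+ l))); last exact: normalM.
    rewrite expgnDr -!mulgA; apply: eqmodM => //; first exact: eqmod_refl.
    by rewrite !mulgA; apply: eqmodM => //; exact: eqmod_refl.
  (* Modulo [N], multiplying by [a^(k * m.-1)] amounts to dividing by [a^k], since [a^(k * m)] lies
     in [N]. *)
  + exists (k * m.-1)%N.
    have -> : x^-1 * a ^+ (k * m.-1) = (a ^+ k * x)^-1 * a ^+ (k * m).
      rewrite invgM -mulgA -{2}(prednK m0) mulnS expgnDr.
      by rewrite (mulgA (a ^- k)) mulVg mul1g.
    apply: normalM => //; first by apply: normalV => //; exact/conjH.
    by rewrite mulnC expgnA; apply: normalX => //; exact: NH.
  + exists k; apply/(eqmod_normal nH (y := (x * a ^+ k) ^ y)); last exact: normalJ.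
    rewrite !conjgE -!mulgA; apply: eqmodM => //; first exact: eqmod_refl.
    by apply: eqmodM => //; first exact: eqmod_refl.
- by exists 0%N; rewrite mulg1.
- exists m.-1; rewrite /= -expgS prednK //; exact: NH.
(* An exponent below [m] moving [x] into [H]. Together with the label of the moved element it
   determines the coset of [x] modulo [N]. *)
pose kx x : 'I_m := xget (Ordinal m0) [set k : 'I_m | H (x * a ^+ k)].
have kxP x : (exists k, H (x * a ^+ k)) -> H (x * a ^+ kx x).
  move=> [k Hk]; rewrite /kx; apply: (@xgetPex _ _ [set k : 'I_m | H (x * a ^+ k)]).
  exists (Ordinal (ltn_pmod k m0)) => /=.
  move: Hk; rewrite {1}(divn_eq k m) addnC expgnDr mulgA => Hk.
  rewrite -(mulgK (a ^+ (k %/ m * m)) (x * _)); apply: normalM => //.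
  by apply: normalV => //; rewrite mulnC expgnA; apply: normalX => //; exact: NH.
exists ('I_m * T)%type, (fun x => (kx x, f (x * a ^+ kx x))).
move=> x y /kxP Hx /kxP Hy [kxy]; rewrite -kxy in Hy *.
by move=> /(fP _ _ Hx Hy)/(eqmodMI nN).
Qed.

Lemma avoiding_maximal_exists g : g != 1 -> exists N, avoiding_maximal N g.
Proof.
move=> /eqP g1; pose P N := N = set0 \/ is_normal N /\ ~ N g.
have [F FP Ftot|N [PN maxN]] := @Zorn_bigcup G P.
  have [[N0 FN0 N00]|F0] := pselect (exists2 N, F N & N <> set0); last first.
    left; apply/seteqP; split=> // x [N FN Nx]; apply: F0; exists N => //.
    by move=> N0; rewrite N0 in Nx.
  have FN N x : F N -> N x -> is_normal N /\ ~ N g.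
    by move=> /FP[->|].
  have F2 A B : F A -> F B -> exists C, [/\ F C, A `<=` C & B `<=` C].
    move=> FA FB; have [AB|BA] := Ftot _ _ FA FB; first by exists B; split.
    by exists A; split.
  right; split; last by case=> N FNN Ng; have [] := FN _ _ FNN Ng.
  split.
  - exists N0 => //; have /set0P[x Nx] : N0 != set0 by apply/eqP.
    by apply: normal1; have [] := FN _ _ FN0 Nx.
  - move=> x y [A FA Ax] [B FB By]; have [C [FC AC BC]] := F2 _ _ FA FB.
    exists C => //; have [nC _] := FN _ _ FC (AC _ Ax).
    by apply: normalM => //; [exact: AC|exact: BC].
  - by move=> x [A FA Ax]; exists A => //; apply: normalV => //;
    have [] := FN _ _ FA Ax.
  - by move=> x y [A FA Ax]; exists A => //; apply: normalJ => //;
    have [] := FN _ _ FA Ax.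
have maxT M : is_normal M -> N `<=` M -> (exists2 x, M x & ~ N x) -> M g.
  move=> nM NM [x Mx Nx]; apply: contrapT => Mg; apply: (maxN M); last by right.
  by split=> // MN; exact/Nx/MN.
exists N; case: PN => [N0|[nN Ng]]; last by [].
exfalso; apply/g1/(maxT _ (is_normal1 G)); rewrite N0 //; by exists 1.
Qed.

(** The entries of [t] are adjoined one at a time. Each is central modulo the current subgroup
    because its commutators with the generators lie there, and [commg_torsion] puts a power of it in
    [N]. *)
Lemma finite_mod_cyclic_extensions N H g s (t : seq G) : avoiding_maximal N g ->
  generated [set` s] = [set: G] -> is_normal H -> N `<=` H -> finite_mod H N ->
  (forall a x, a \in t -> x \in s -> H [~ a, x]) ->
  exists H', [/\ is_normal H', H `<=` H', [set` t] `<=` H' & finite_mod H' N].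
Proof.
move=> maxN sG; have nN : is_normal N by case: maxN.
elim: t H => [|a t IHt] H nH NH fH Ht; first by exists H; split.
have Ha x : x \in s -> H [~ a, x] by apply: Ht; rewrite mem_head.
have [m m0 Nam] := commg_torsion maxN nH fH sG Ha.
have HaT y : cent_mod H a y.
  have : generated [set` s] y by rewrite sG.
  by apply: cent_mod_generated => // x /=; exact: Ha.
have [H' [nH' HH' H'a fH']] := cyclic_extension nN nH NH fH HaT m0 Nam.
have [|b x tb xs|H2 [nH2 H'H2 tH2 fH2]] := IHt H' nH' _ fH'.
- exact: subset_trans NH HH'.
- by apply/HH'/Ht => //; rewrite inE tb orbT.
exists H2; split=> //; first exact: subset_trans HH' H'H2.
by move=> x /=; rewrite inE => /predU1P[->|]; [exact: H'H2|exact: tH2].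
Qed.

(** The left-normed commutators of weight [k + 1] with entries in [s]; the shift matches
    [lower_central 0] being the whole group. *)
Definition weighted_commutators s k : seq G :=
  iter k (fun t => [seq [~ a, x] | a <- t, x <- s]) s.

Lemma weighted_commutators_lower_central s k a :
  a \in weighted_commutators s k -> lower_central k a.
Proof.
elim: k a => //= k IHk _ /allpairsP[[a x] /= [ta _ ->]].
by apply: sub_gen_smallest; exists a; [exact: IHk|exists x].
Qed.

Theorem nilpotent_residually_finite g :
  finitely_generated G -> nilpotent_group G -> g != 1 ->
  exists N, [/\ is_normal N, ~ N g & finite_mod [set: G] N].
Proof.
move=> [A finA AG] [c nilG] /avoiding_maximal_exists[N maxN].
have [nN Ng _] := maxN; exists N; split=> //.
have /finite_seqP[s As] := finA; rewrite {}As in AG.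
have [H [nH _ sH fH]] : exists H, [/\ is_normal H, N `<=` H,
    [set` weighted_commutators s (c - c)] `<=` H & finite_mod H N].
  (* Descending induction on the level [c - i]. Level [c] is trivial by nilpotency; commutators of
     level [c - i.+1] with generators are of level [c - i], hence already in [H]. Level 0 is the
     generating list itself. *)
  elim: {2}c => [|i [H [nH NH Hi fH]]].
    exists N; split=> // [a /=|].
      by rewrite subn0 => /weighted_commutators_lower_central; rewrite nilG => ->;
        exact: normal1.
    by exists unit, (fun=> tt) => x y Nx Ny _; apply: normalM => //; exact: normalV.
  have [lt_ic|le_ci] := ltnP i c; last first.
    exists H; split=> // a /=; rewrite (eqnP (leqW le_ci)) => ?.
    by apply: Hi; rewrite /= (eqnP le_ci).
  have [|H' [nH' HH' tH' fH']] := finite_mod_cyclic_extensions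
    (t := weighted_commutators s (c - i.+1)) maxN AG nH NH fH.
    move=> a x ta xs; apply: Hi; rewrite /= -(subnSK lt_ic) /=.
    by apply/allpairsP; exists (a, x).
  by exists H'; split=> //; exact: subset_trans NH HH'.
have {}sH : [set` s] `<=` H by move=> x xs; apply: sH; rewrite /= subnn.
suff -> : [set: G] = H by [].
apply/seteqP; split=> // x _; have : generated [set` s] x by rewrite AG.
by apply: generated_ind => // *; [exact: normal1|exact: normalM|exact: normalV].
Qed.

End NilpotentResidualFiniteness.

(** * Unitary matrix representations and the permutation representation on cosets *)

Section UnitaryMatrixRepresentations.
Variables (C : numClosedFieldType) (G : groupType).
Local Open Scope sesquilinear_scope.

(* Matrices act on row vectors, so a representation reverses products. *)
Definition unitary_mxrep n (rho : G -> 'M[C]_n) : Prop :=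
  [/\ rho 1%g = 1%:M, forall g h, rho (g * h)%g = rho h *m rho g
    & forall g, rho g *m (rho g) ^t* = 1%:M].

Lemma coset_representatives (N : set G) :
  is_normal N -> finite_mod [set: G] N ->
  exists n (r : 'I_n -> G) (c : G -> 'I_n),
    [/\ forall x, eqmod N (r (c x)) x, forall i, c (r i) = i
      & forall x y, eqmod N x y -> c x = c y].
Proof.
move=> nN [T [f fP]].
(* Congruent elements define the same set, so the choice is constant on cosets. Labelling [rep x]
   instead of [x] therefore gives exactly one label per coset. *)
pose rep x := xget 1%g (eqmod N x).
have repP x : eqmod N x (rep x).
  by rewrite /rep; case: xgetP => // /(_ x) []; exact: eqmod_refl.
have rep_eq x y : eqmod N x y -> rep x = rep y.
  move=> xy; rewrite /rep; congr xget; apply/funext => z; apply/propext; split=> h.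
    exact: (eqmod_trans nN (eqmod_sym nN xy) h).
  exact: (eqmod_trans nN xy h).
pose D := [set t | `[< exists x, f (rep x) = t >]]%SET.
have DP x : f (rep x) \in D by rewrite inE; apply/asboolP; exists x.
pose c x := enum_rank_in (DP 1%g) (f (rep x)).
have ex_r (i : 'I_#|D|) : exists x, f (rep x) = enum_val i.
  by have := enum_valP i; rewrite inE => /asboolP.
pose r i := sval (cid (ex_r i)).
have rP i : f (rep (r i)) = enum_val i by rewrite /r; case: cid.
exists #|D|, r, c; split=> [x|i|x y xy].
- have /fP : f (rep (r (c x))) = f (rep x) by rewrite rP enum_rankK_in.
  move=> /(_ I I) h; apply: (eqmod_trans nN (repP _)).
  exact: (eqmod_trans nN h (eqmod_sym nN (repP x))).
- by apply: enum_val_inj; rewrite enum_rankK_in.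
- by rewrite /c (rep_eq _ _ xy).
Qed.

(** Left translation permutes the cosets. By normality [g] fixes a coset if and only if it lies in
    [N], so it fixes all of them or none, which gives the trace. *)
Lemma coset_mxrep (N : set G) : is_normal N -> finite_mod [set: G] N ->
  exists n (rho : G -> 'M[C]_n), [/\ (0 < n)%N, unitary_mxrep rho
    & forall g, \tr (rho g) = if `[< N g >] then n%:R else 0].
Proof.
move=> nN /(coset_representatives nN)[n [r [c [rc cr cE]]]].
have cP x i : (c x == i) = `[< eqmod N x (r i) >].
  apply/eqP/asboolP => [<-|/cE->//]; exact: eqmod_sym.
pose rho g : 'M[C]_n := \matrix_(i, j) (c (g * r i)%g == j)%:R.
exists n, rho; split; first by apply: leq_ltn_trans (ltn_ord (c 1%g)).
  split=> [|g h|g]; apply/matrixP => i j; rewrite !mxE.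
  - by rewrite mul1g cr.
  - rewrite (bigD1 (c (h * r i)%g)) //= big1 => [|k /negPf kc].
      rewrite !mxE eqxx mul1r addr0; congr (_ == _)%:R.
      apply: cE; rewrite -mulgA; apply: (eqmodM nN (eqmod_refl nN _)).
      exact: eqmod_sym.
    by rewrite !mxE eq_sym kc mul0r.
  - rewrite (bigD1 (c (g * r i)%g)) //= big1 => [|k /negPf kc].
      rewrite !mxE eqxx mul1r addr0 rmorph_nat eq_sym; congr (nat_of_bool _)%:R.
      apply/eqP/eqP => [cij|->//]; rewrite -(cr i) -(cr j).
      apply: cE; apply: (@eqmodIM _ _ _ _ g).
      apply: (eqmod_trans nN (eqmod_sym nN (rc _))).
      by rewrite cij; exact: rc.
    by rewrite !mxE eq_sym kc mul0r.
move=> g; rewrite /mxtrace; under eq_bigr do rewrite mxE cP.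
have Ng i : `[< eqmod N (g * r i)%g (r i) >] = `[< N g >].
  apply: asbool_equiv_eq; rewrite /eqmod invgM -mulgA mulgA.
  rewrite -(normalJE nN g (r i)) conjgE; split=> /(normalV nN).
    by rewrite !gnorm.
  by rewrite !gnorm.
under eq_bigr do rewrite Ng.
by case: ifP => _; rewrite sumr_const card_ord // mul0rn.
Qed.

End UnitaryMatrixRepresentations.

(** * Orthogonal decomposition into irreducible matrix representations *)

Section Decomposition.
Variable C : numClosedFieldType.
Local Open Scope sesquilinear_scope.

Lemma adjmxM m n p (A : 'M[C]_(m, n)) (B : 'M[C]_(n, p)) :
  (A *m B) ^t* = B ^t* *m A ^t*.
Proof. by rewrite trmx_mul map_mxM. Qed.

Lemma adjmxB m n (A B : 'M[C]_(m, n)) : (A - B) ^t* = A ^t* - B ^t*.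
Proof. by rewrite !raddfB. Qed.

Lemma adjmx1 n : (1%:M : 'M[C]_n) ^t* = 1%:M.
Proof. by rewrite trmx1 map_mx1. Qed.

Lemma orthonormal_basis m n (U : 'M[C]_(m, n)) :
  exists B : 'M[C]_(\rank U, n), B *m B ^t* = 1%:M /\ (B :=: U)%MS.
Proof.
exists (schmidt (row_base U)); split.
  by apply/unitarymxP/schmidt_unitarymx/rank_leq_col.
apply: eqmx_trans (eq_row_base U).
by apply: eqmx_schmidt_free; exact: row_base_free.
Qed.

Variable G : groupType.

Definition irr_mxrep n (rho : G -> 'M[C]_n) : Prop :=
  [/\ unitary_mxrep rho, (0 < n)%N & forall U : 'M[C]_n,
    (forall g, (U *m rho g <= U)%MS) -> U = 0 \/ row_full U].

Lemma unitary_mxrepV n (rho : G -> 'M[C]_n) g :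
  unitary_mxrep rho -> (rho g) ^t* = rho g^-1%g.
Proof.
move=> [rho1 rhoM rhoU]; rewrite -[LHS]mul1mx -rho1 -(mulgV g) rhoM -mulmxA.
by rewrite rhoU mulmx1.
Qed.

Section Compression.
Variables (n : nat) (rho : G -> 'M[C]_n) (r : nat) (B : 'M[C]_(r, n)).
Hypotheses (rhoP : unitary_mxrep rho) (BB : B *m B ^t* = 1%:M).
Hypothesis Binv : forall g, (B *m rho g <= B)%MS.

(** The restriction of [rho g] to the invariant row space of [B], in the coordinates of its
    orthonormal rows. *)
Definition compression g : 'M[C]_r := B *m rho g *m B ^t*.

Lemma compressionE g : compression g *m B = B *m rho g.
Proof.
have /submxP[X XE] := Binv g.
by rewrite /compression XE -[X *m B *m _]mulmxA BB mulmx1.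
Qed.

Lemma compression_unitary : unitary_mxrep compression.
Proof.
have [rho1 rhoM rhoU] := rhoP; split=> [|g h|g].
- by rewrite /compression rho1 mulmx1.
- by rewrite {1}/compression rhoM !mulmxA -compressionE -!mulmxA.
- rewrite {2}/compression !adjmxM trmxCK !mulmxA compressionE.
  by rewrite -(mulmxA B) rhoU mulmx1.
Qed.

(** The trace is expressed by the orthogonal projection onto the row space, so that complementary
    compressions have traces adding up to that of [rho g]. *)
Lemma compression_trace g : \tr (compression g) = \tr (B ^t* *m B *m rho g).
Proof. by rewrite /compression mxtrace_mulC mulmxA. Qed.

(* [(rho g)^* = rho g^-1], so the orthogonal complement is invariant as well. *)
Lemma projection_comm g : B ^t* *m B *m rho g = rho g *m (B ^t* *m B).
Proof.
set E := B ^t* *m B.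
have EA : E ^t* = E by rewrite /E adjmxM trmxCK.
have key h : E *m rho h = E *m rho h *m E.
  rewrite /E -!mulmxA; congr (_ *m _).
  by rewrite !mulmxA -compressionE -(mulmxA _ B) BB mulmx1.
clearbody E.
have := congr1 (fun M : 'M[C]_n => M ^t* ) (key g^-1%g).
rewrite !adjmxM EA (unitary_mxrepV _ rhoP) invgK => ->.
by rewrite mulmxA -key.
Qed.

End Compression.

(** Take an orthonormal basis [B'] of the range of the complementary projection [1 - E]. The
    projection defined by [B'] has the same range and both are self-adjoint, hence they agree. *)
Lemma complement_basis n r (B : 'M[C]_(r, n)) : B *m B ^t* = 1%:M ->
  exists r' (B' : 'M[C]_(r', n)),
    B' *m B' ^t* = 1%:M /\ B ^t* *m B + B' ^t* *m B' = 1%:M.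
Proof.
move=> BB; set E := B ^t* *m B.
have EA : E ^t* = E by rewrite /E adjmxM trmxCK.
have [r' [B' [BB' eqB']]] : exists r' (B' : 'M[C]_(r', n)),
    B' *m B' ^t* = 1%:M /\ (B' :=: 1%:M - E)%MS.
  by exists (\rank (1%:M - E)); exact: orthonormal_basis.
exists r', B'; split=> //.
have /submxP[X XE] : (1%:M - E <= B')%MS by rewrite eqB'.
have FA : (1%:M - E) ^t* = 1%:M - E by rewrite adjmxB EA adjmx1.
have EE : E *m E = E by rewrite /E mulmxA -(mulmxA _ B) BB mulmx1.
have FF : (1%:M - E) *m (1%:M - E) = 1%:M - E.
  by rewrite mulmxBl mul1mx mulmxBr mulmx1 EE subrr subr0.
have B'F : B' *m (1%:M - E) = B'.
  have /submxP[Y ->] : (B' <= 1%:M - E)%MS by rewrite eqB'.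
  by rewrite -mulmxA FF.
suff -> : B' ^t* *m B' = 1%:M - E by rewrite addrC subrK.
have B'A : (1%:M - E) *m B' ^t* = B' ^t* by rewrite -{2}B'F adjmxM FA.
have FBB : (1%:M - E) *m (B' ^t* *m B') = 1%:M - E.
  by rewrite XE -!mulmxA (mulmxA B') BB' mul1mx.
by rewrite -B'A -mulmxA.
Qed.

(** Complete reducibility as an induction principle on characters: a reducible representation splits
    along a proper invariant subspace and its orthogonal complement, both of smaller positive
    dimension. *)
Lemma mxrep_trace_ind (P : (G -> C) -> Prop) :
  (forall n (rho : G -> 'M[C]_n), irr_mxrep rho -> P (fun g => \tr (rho g))) ->
  (forall f h, P f -> P h -> P (fun g => f g + h g)) ->
  forall n (rho : G -> 'M[C]_n), (0 < n)%N -> unitary_mxrep rho ->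
    P (fun g => \tr (rho g)).
Proof.
move=> Pirr PD; elim/ltn_ind => n IHn rho n0 rhoP.
have [/Pirr//|nirr] := pselect (irr_mxrep rho).
have [U Uinv [U0 Ufull]] : exists2 U : 'M[C]_n,
    forall g, (U *m rho g <= U)%MS & U <> 0 /\ ~ row_full U.
  apply: contra_notP nirr => h; split=> // U Uinv.
  have [->|U0] := pselect (U = 0); first by left.
  by right; apply: contrapT => Ufull; apply: h; exists U.
have [B [BB eqB]] := orthonormal_basis U.
have Binv g : (B *m rho g <= B)%MS.
  by apply: submx_trans (submxMr (rho g) _) _; rewrite ?eqB.
have [r' [B' [BB' BD]]] := complement_basis BB.
have Bcomm g := projection_comm rhoP BB Binv g.
(* The complementary projection commutes with [rho g] too, so its range is invariant. *)
have B'inv g : (B' *m rho g <= B')%MS.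
  have B'E : B' *m (B' ^t* *m B') = B' by rewrite mulmxA BB' mul1mx.
  rewrite -{1}B'E.
  have -> : B' ^t* *m B' = 1%:M - B ^t* *m B by rewrite -BD addrAC subrr add0r.
  rewrite -mulmxA mulmxBl mul1mx Bcomm -[X in X - _]mulmx1 -mulmxBr.
  rewrite -BD addrAC subrr add0r !mulmxA.
  exact: submxMl.
have rn : (\rank U < n)%N.
  by rewrite ltn_neqAle rank_leq_col andbT; apply/negP.
have r0 : (0 < \rank U)%N by rewrite lt0n mxrank_eq0; apply/eqP.
(* Dimensions are compared through the traces of the two projections, in characteristic zero. *)
have rr' : (\rank U + r' = n)%N.
  apply/eqP; rewrite -(eqr_nat C) natrD -!mxtrace1 -BB -BB' -BD.
  by rewrite raddfD /= !(mxtrace_mulC (_ ^t* )).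
have -> : (fun g => \tr (rho g)) =
    (fun g => \tr (compression rho B g) + \tr (compression rho B' g)).
  apply/funext => g; rewrite !compression_trace -raddfD /= -mulmxDl BD.
  by rewrite mul1mx.
have [lt_r'n r'0] : (r' < n)%N /\ (0 < r')%N by lia.
by apply: PD; apply: IHn => //; exact: compression_unitary.
Qed.

(** Among the matrices whose row space lies in [W], one of maximal rank spans [W]: adding a vector
    of [W] outside its row space would raise the rank. This links invariant sets of vectors to
    invariant row spaces. *)
Lemma subspace_mx n (W : set 'rV[C]_n) : submod_closed (mem W) ->
  exists U : 'M[C]_n, forall v, W v <-> (v <= U)%MS.
Proof.
move=> [W0 WL].
have WM m (A : 'M[C]_(m, n)) v : (forall i, W (row i A)) -> (v <= A)%MS -> W v.
  move=> WA /submxP[u ->]; rewrite mulmx_sum_row.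
  apply: (@big_ind _ W) => [|x y Wx Wy|i _].
  - by apply: set_mem.
  - by apply/set_mem; rewrite -[x]scale1r; apply: (WL); apply/mem_set.
  - apply/set_mem; rewrite -[_ *: _]addr0; apply: (WL) => //.
    by apply/mem_set/WA.
pose Q k := `[< exists U : 'M[C]_n, (forall v, (v <= U)%MS -> W v) /\ \rank U = k >].
have exQ : exists k, Q k.
  exists 0%N; apply/asboolP; exists 0; split; last exact: mxrank0.
  by move=> v; rewrite submx0 => /eqP ->; exact: set_mem.
have bdQ k : Q k -> (k <= n)%N by move=> /asboolP[U [_ <-]]; exact: rank_leq_col.
case: (ex_maxnP exQ bdQ) => k /asboolP[U [WU rU]] maxk.
exists U => v; split=> [Wv|]; last exact: WU.
have : Q (\rank (U + v)%MS).
  apply/asboolP; exists (U + v)%MS; split=> // w.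
  move=> /sub_addsmxP[[a b] /= ->].
  apply/set_mem; rewrite -[a *m U]scale1r; apply: (WL); apply/mem_set.
    by apply: WU; exact: submxMl.
  rewrite (mx11_scalar b) mul_scalar_mx -[_ *: _]addr0.
  by apply/set_mem; apply: (WL) => //; exact/mem_set.
move=> /maxk; rewrite -rU => le_rank.
have /eqmxP/eqmx_sym eqU : (U == U + v)%MS.
  by rewrite -(mxrank_leqif_eq (addsmxSl U v)) eqn_leq le_rank mxrankS // addsmxSl.
by rewrite -eqU addsmxSr.
Qed.

End Decomposition.

(** * Row vectors with the Euclidean norm as a Hilbert space *)

Section ComplexNorm.
Variable R : realType.
Implicit Types z : R[i].

Lemma norm_iC : `|'i%C : R[i]| = 1.
Proof. by rewrite normc_def /= expr0n expr1n add0r sqrtr1. Qed.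

Lemma norm_Im_le z : `|complex.Im z|%:C <= `|z|.
Proof.
have -> : complex.Im z = complex.Re (- 'i%C * z) by case: z => a b; simpc.
apply: le_trans (normc_ge_Re _) _; by rewrite normrM normrN norm_iC mul1r.
Qed.

Lemma norm_le_ReIm z : `|z| <= (`|complex.Re z| + `|complex.Im z|)%:C.
Proof.
rewrite [in leLHS](complexE z); apply: le_trans (ler_normD _ _) _.
rewrite normrM rmorphD /= lerD //.
  by rewrite normc_def /= expr0n addr0 sqrtr_sqr.
by rewrite norm_iC mul1r normc_def /= expr0n addr0 sqrtr_sqr.
Qed.

Lemma gt0_realC z : 0 < z -> exists2 e : R, 0 < e & z = e%:C.
Proof.
by case: z => a b; rewrite ltcE /= => /andP[/eqP -> a0]; exists a.
Qed.

End ComplexNorm.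

Section L2.
Variables (R : realType) (n : nat).

(** An alias that takes over only the module structure of row vectors, so that its norm is the
    Euclidean one and not the maximum norm of matrices. *)
Definition l2 : Type := 'rV[R[i]]_n.

HB.instance Definition _ := GRing.Lmodule.on l2.

Definition l2norm (v : l2) : R[i] := sqrtC (dotmx v v).

Lemma l2normD (u v : l2) : l2norm (u + v) <= l2norm u + l2norm v.
Proof. exact: (triangle_lerif (@dotmx R[i] n) u v). Qed.

Lemma l2normZ (a : R[i]) (v : l2) : l2norm (a *: v) = `|a| * l2norm v.
Proof.
rewrite /l2norm (dnormZ (@dotmx R[i] n)) sqrtCM ?nnegrE ?exprn_ge0 ?dnorm_ge0 //.
by rewrite sqrCK.
Qed.

Lemma l2norm_eq0 (v : l2) : l2norm v = 0 -> v = 0.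
Proof. by move/eqP; rewrite (sqrt_dnorm_eq0 (@dotmx R[i] n)) => /eqP. Qed.

HB.instance Definition _ :=
  Lmodule_isNormed.Build R[i] l2 l2normD l2normZ l2norm_eq0.

Lemma l2_normE (v : l2) : `|v| = sqrtC (dotmx v v).
Proof. by []. Qed.


Lemma l2_norm_delta (i : 'I_n) : `|(delta_mx 0 i : l2)| = 1.
Proof.
rewrite l2_normE dotmxE mxE (bigD1 i) //= big1 => [|j /negPf ji].
  by rewrite !mxE !eqxx addr0 mul1r conjC1 sqrtC1.
by rewrite !mxE ji mul0r.
Qed.

Lemma l2_norm_le_sum (v : l2) : `|v| <= \sum_i `|v 0 i|.
Proof.
rewrite [in leLHS](row_sum_delta v); apply: le_trans (ler_norm_sum _ _ _) _.
by apply: ler_sum => i _; rewrite (@normrZ _ l2) l2_norm_delta mulr1.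
Qed.

Lemma l2_coord_le (v : l2) i : `|v 0 i| <= `|v|.
Proof.
have -> : v 0 i = dotmx v (delta_mx 0 i).
  rewrite dotmxE mxE (bigD1 i) //= big1 => [|j /negPf ji].
    by rewrite !mxE !eqxx addr0 conjC1 mulr1.
  by rewrite !mxE ji conjC0 mulr0.
apply: le_trans (CauchySchwarz_sqrt (@dotmx R[i] n) v (delta_mx 0 i)) _.
by rewrite -[sqrtC (dotmx (delta_mx 0 i) _)]l2_normE l2_norm_delta mulr1.
Qed.

Definition l2_coord (b : bool) (i : 'I_n) (v : l2) : R :=
  if b then complex.Re (v 0 i) else complex.Im (v 0 i).

Lemma l2_coord_lipschitz b i (u v : l2) :
  `|l2_coord b i u - l2_coord b i v|%:C <= `|u - v|.
Proof.
apply: le_trans (l2_coord_le (u - v) i); rewrite !mxE.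
case: b => /=; first by rewrite -raddfB; exact: normc_ge_Re.
by rewrite -raddfB; exact: norm_Im_le.
Qed.

(** The [2n] real coordinates are 1-Lipschitz, so they converge; the norm is at most the sum of
    their absolute values, so their limits assemble to the limit of [F]. *)
Lemma l2_complete (F : set_system l2) : ProperFilter F -> cauchy F -> cvg F.
Proof.
move=> FF /cauchyP Fex.
have coord_cvg b i : cvg (l2_coord b i @ F).
  apply/cauchy_cvgP/cauchyP => e e0.
  have [|x Fx] := Fex e%:C; first by rewrite ltcR.
  exists (l2_coord b i x); rewrite nbhs_filterE /fmap /=.
  apply: (@filterS _ F _ _ _ _ Fx) => y /=.
  rewrite -!ball_normE /= => xy; rewrite -ltcR.
  exact: (le_lt_trans (l2_coord_lipschitz b i x y) xy).
pose l b i := lim (l2_coord b i @ F).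
pose v : l2 := \row_i (l true i +i* l false i).
apply/cvg_ex; exists v; apply/cvg_ballP => _ /gt0_realC[e e0 ->].
(* The [2n] coordinate errors add up to at most [2 * n * d], which is strictly below [e] also when
   [n = 0]. *)
pose d := e / (2 * n.+1)%:R.
have d0 : 0 < d by rewrite divr_gt0 // ltr0n muln_gt0.
have near_l b i : \forall x \near F, `|l b i - l2_coord b i x| < d.
  by have /cvgrPdist_lt := coord_cvg b i; apply.
have : \forall x \near F, forall p : bool * 'I_n,
    `|l p.1 p.2 - l2_coord p.1 p.2 x| < d.
  by apply: filter_forall => -[b i]; exact: near_l.
apply: filterS => x Hx; rewrite -ball_normE /=.
apply: le_lt_trans (l2_norm_le_sum _) _.
apply: (@le_lt_trans _ _ (\sum_(i < n) (2 * d)%:C)).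
  apply: ler_sum => i _; apply: le_trans (norm_le_ReIm _) _.
  rewrite lecR !mxE mulr2n mulrDl !mul1r !raddfB /= lerD //.
    exact/ltW/(Hx (true, i)).
  exact/ltW/(Hx (false, i)).
rewrite sumr_const card_ord -rmorphMn ltcR /d -mulr_natl.
rewrite !mulrA ltr_pdivrMr ?ltr0n // [ltLHS]mulrC ltr_pM2l //.
by rewrite -natrM ltr_nat; lia.
Qed.

HB.instance Definition _ := Uniform_isComplete.Build l2 l2_complete.

Definition l2_dot : {dot l2 for @Num.conj R[i]} := @dotmx R[i] n.

Lemma l2_dot_norm (v : l2) : l2_dot v v = `|v| ^+ 2.
Proof. by rewrite l2_normE sqrtCK. Qed.

Definition l2_hilbert : hilbertSpace R := HilbertSpace l2_dot_norm.

End L2.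

(** * Classes in the unitary dual of irreducible matrix representations *)

Section MatrixRepresentationClasses.
Variables (R : realType) (Gamma : groupType).

Section Rep.
Variables (n : nat) (rho : Gamma -> 'M[R[i]]_n) (rhoP : unitary_mxrep rho).

Definition mxrep_op (g : Gamma) : {linear l2_hilbert R n -> l2_hilbert R n} :=
  mulmxr (rho g).

Lemma mxrep_opE g v : mxrep_op g v = v *m rho g. Proof. by []. Qed.

Lemma mxrep_op1 v : mxrep_op 1%g v = v.
Proof. by case: rhoP => rho1 _ _; rewrite mxrep_opE rho1 mulmx1. Qed.

Lemma mxrep_opM g h v : mxrep_op (g * h)%g v = mxrep_op g (mxrep_op h v).
Proof. by case: rhoP => _ rhoM _; rewrite !mxrep_opE rhoM mulmxA. Qed.

Lemma mxrep_op_unitary g u v :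
  hdot (l2_hilbert R n) (mxrep_op g u) (mxrep_op g v) = hdot (l2_hilbert R n) u v.
Proof.
case: rhoP => _ _ rhoU; rewrite /= /l2_dot !dotmxE adjmxM.
by rewrite mulmxA -(mulmxA u) rhoU mulmx1.
Qed.

Definition rep_of_mxrep : unitary_rep R Gamma :=
  UnitaryRep mxrep_op1 mxrep_opM mxrep_op_unitary.

End Rep.

Lemma irreducible_rep_of_mxrep n (rho : Gamma -> 'M[R[i]]_n)
  (irr : irr_mxrep rho) (rhoP : unitary_mxrep rho) :
  irreducible_rep (rep_of_mxrep rhoP).
Proof.
case: irr => _ n0 irr; split=> [|W _ subW Winv].
  exists (delta_mx 0 (Ordinal n0) : 'rV_n); apply/eqP => /rowP/(_ (Ordinal n0)).
  by rewrite !mxE !eqxx => /eqP; rewrite oner_eq0.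
have [U WU] := subspace_mx subW.
have [g|U0|Ufull] := irr U.
- by apply/row_subP => i; rewrite row_mul; apply/WU/Winv/WU; exact: row_sub.
- left; apply/seteqP; split=> v /=; first by move/WU; rewrite U0 submx0 => /eqP.
  by move=> ->; apply/WU; exact: sub0mx.
- by right; apply/seteqP; split=> // v _; apply/WU; exact: submx_full.
Qed.

Lemma unitary_equiv_refl (pi : unitary_rep R Gamma) : unitary_equiv pi pi.
Proof. by exists idfun; split=> //; exists id. Qed.

Definition irr_class n (rho : Gamma -> 'M[R[i]]_n) (irr : irr_mxrep rho) :
    unitary_dual R Gamma :=
  let rhoP := let: And3 P _ _ := irr in P in
  exist _ (unitary_equiv (rep_of_mxrep rhoP))
    (ex_intro2 _ _ (rep_of_mxrep rhoP)
      (irreducible_rep_of_mxrep irr rhoP) erefl).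

Lemma intertwining_isometry n (rho : Gamma -> 'M[R[i]]_n) (irr : irr_mxrep rho)
  sigma : sval (irr_class irr) sigma ->
  exists2 U : {linear l2 R n -> rep_space sigma}, bijective U &
    (forall v, `|U v| = `|v|) /\ forall g v, U (v *m rho g) = sigma g (U v).
Proof.
move=> [U [bijU dotU Urho]]; exists U => //; split=> // v.
apply/eqP; rewrite -(eqrXn2 (n := 2)) ?normr_ge0 //; apply/eqP.
by rewrite -hdot_norm dotU l2_dot_norm.
Qed.

Lemma irr_class_fin n (rho : Gamma -> 'M[R[i]]_n) (irr : irr_mxrep rho) :
  unitary_dual_fin (irr_class irr).
Proof.
exists (rep_of_mxrep (let: And3 P _ _ := irr in P)) => /=.
  exact: unitary_equiv_refl.
exists n; constructor; exists id => //; by exists id.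
Qed.

End MatrixRepresentationClasses.

(** * Finite absolute sums and small tails *)

Section AbsoluteSums.
Variables (R : realType) (I : choiceType).
Implicit Types (f : I -> R[i]) (F J : {fset I}).

Definition abs_sum f J : R := \sum_(g <- J) complex.Re `|f g|.

(** The l^1-mass of [f] outside [F] is at most [eps], tested on finite sets only. *)
Definition small_tail f F (eps : R) : Prop :=
  forall J, [disjoint F & J]%fset -> abs_sum f J <= eps.

Lemma Re_ge0E (z : R[i]) : 0 <= z -> (complex.Re z)%:C = z.
Proof. by move=> z0; rewrite RRe_real ?ger0_real. Qed.

Lemma Re_normE (z : R[i]) : (complex.Re `|z|)%:C = `|z|.
Proof. by rewrite Re_ge0E. Qed.

Lemma Re_vnormE (V : normedZmodType R[i]) (z : V) : (complex.Re `|z|)%:C = `|z|.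
Proof. by rewrite Re_ge0E. Qed.

Lemma Re_norm_ge0 (z : R[i]) : 0 <= complex.Re `|z|.
Proof. by rewrite -ler0c Re_normE. Qed.

Lemma Re_vnorm_ge0 (V : normedZmodType R[i]) (z : V) : 0 <= complex.Re `|z|.
Proof. by rewrite -ler0c Re_vnormE. Qed.

Lemma fsetU_perm F J : [disjoint F & J]%fset ->
  perm_eq (F `|` J)%fset (F ++ J).
Proof.
move=> /fdisjointP FJ; apply: uniq_perm; first exact: fset_uniq.
  rewrite cat_uniq !fset_uniq /= andbT; apply/hasPn => x xJ.
  by apply: contraTN xJ => /FJ.
by move=> x; rewrite inE mem_cat.
Qed.

Lemma abs_sumU f F J : [disjoint F & J]%fset ->
  abs_sum f (F `|` J)%fset = abs_sum f F + abs_sum f J.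
Proof. by move=> FJ; rewrite /abs_sum (perm_big _ (fsetU_perm FJ)) big_cat. Qed.

Lemma abs_sum_bounded f :
  summable [set: I] (fun g => (complex.Re `|f g|)%:E) ->
  exists B, forall J, abs_sum f J <= B.
Proof.
rewrite summableE => fin; exists (fine (esum [set: I]
  (fun g => `|(complex.Re `|f g|)%:E|)%E)) => J.
rewrite -lee_fin fineK //; apply: ereal_sup_ubound; exists [set` J].
  by split=> //; exact: finite_fset.
rewrite fsbig_finite /=; last exact: finite_fset.
rewrite set_fsetK /abs_sum -sumEFin; apply: eq_bigr => g _.
by rewrite ger0_norm ?Re_norm_ge0.
Qed.

(** A finite set whose absolute sum is within [eps] of the supremum leaves at most [eps] for any
    disjoint set. Enlarging it by [F1] lets the identity be included later. *)
Lemma small_tail_exists f (eps : R) (F1 : {fset I}) :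
  summable [set: I] (fun g => (complex.Re `|f g|)%:E) -> 0 < eps ->
  exists2 F, (F1 `<=` F)%fset & small_tail f F eps.
Proof.
move=> /abs_sum_bounded[B fB] eps0.
pose A := [set abs_sum f J | J in [set: {fset I}]].
have supA : has_sup A.
  split; first by exists (abs_sum f fset0), fset0.
  by exists B => _ [J _ <-].
have [_ [F _ <-] FA] := sup_adherent eps0 supA.
exists (F1 `|` F)%fset => [|J]; first exact: fsubsetUl.
rewrite fdisjointUX => /andP[_ FJ].
have : abs_sum f (F `|` J)%fset <= sup A.
  by apply: sup_upper_bound => //; exists (F `|` J)%fset.
by rewrite abs_sumU //; lra.
Qed.

End AbsoluteSums.

(** * Convergence and linearity of the Fourier transform on vectors *)

Section FourierTransform.
Variables (R : realType) (Gamma : groupType) (pi : unitary_rep R Gamma).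
Variable f : Gamma -> R[i].
Hypothesis fL1 : L1 f.
Local Notation H := (rep_space pi).
Implicit Types (v : H) (F J : {fset Gamma}).

Lemma rep_norm g v : `|pi g v| = `|v|.
Proof.
apply/eqP; rewrite -(eqrXn2 (n := 2)) ?normr_ge0 //; apply/eqP.
by rewrite -!hdot_norm rep_op_unitary.
Qed.

Definition fourier_sum J v : H := \sum_(g <- J) f g *: pi g v.

Lemma fourier_sum_le J v : `|fourier_sum J v| <= (abs_sum f J)%:C * `|v|.
Proof.
apply: le_trans (ler_norm_sum _ _ _) _.
rewrite rmorph_sum mulr_suml; apply: ler_sum => g _.
by rewrite normrZ rep_norm /= Re_normE.
Qed.

Lemma fourier_sum_tail F J eps v : small_tail f F eps -> (F `<=` J)%fset ->
  `|fourier_sum J v - fourier_sum F v| <= eps%:C * `|v|.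
Proof.
move=> tF FJ; have dFJ : [disjoint F & J `\` F]%fset.
  by apply/fdisjointP => x xF; rewrite inE xF.
have JE : (F `|` (J `\` F) = J)%fset.
  apply/fsetP => x; rewrite !inE; case xF: (x \in F) => //=.
  by rewrite (fsubsetP FJ).
rewrite /fourier_sum -[in X in X - _]JE (perm_big _ (fsetU_perm dFJ)) big_cat /=.
rewrite addrAC subrr add0r; apply: le_trans (fourier_sum_le _ _) _.
by rewrite ler_wpM2r // lecR; exact: tF.
Qed.

Lemma partial_sumE v :
  summability.partial_sum (fun g => f g *: pi g v) = fourier_sum^~ v.
Proof.
by apply/funext => J; rewrite /summability.partial_sum /fourier_sum big_seq_fsetE.
Qed.

Lemma totally_superset F :
  \forall J \near @summability.totally Gamma, (F `<=` J)%fset.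
Proof. by exists F. Qed.

#[local] Existing Instance summability.totally_filter.

(** The operators are isometries, so small tails of [f] make the net of partial sums Cauchy, and the
    space is complete. *)
Lemma fourier_cvg v : fourier_sum^~ v @ summability.totally --> fourier f v.
Proof.
rewrite /fourier /summability.sum partial_sumE; apply/cauchy_cvgP/cauchyP.
move=> _ /gt0_realC[e e0 ->].
(* A positive strict bound on the norm of [v] can be divided by even when [v = 0]. *)
have [b b0 vb] : exists2 b : R, 0 < b & `|v| < b%:C.
  exists (complex.Re `|v| + 1); first by have := Re_vnorm_ge0 v; lra.
  by rewrite -Re_vnormE ltcR; lra.
have eb0 : 0 < e / b by rewrite divr_gt0.
have [F _ tF] := small_tail_exists fset0 fL1 eb0.
exists (fourier_sum F v); rewrite nbhs_filterE /fmap /=.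
apply: filterS (totally_superset F) => J FJ; rewrite -ball_normE /= distrC.
apply: le_lt_trans (fourier_sum_tail v tF FJ) _.
move: vb; rewrite -Re_vnormE -rmorphM !ltcR => vb.
by rewrite mulrAC ltr_pdivrMr // ltr_pM2l.
Qed.

Lemma fourier_tail F eps v : small_tail f F eps ->
  `|fourier f v - fourier_sum F v| <= eps%:C * `|v|.
Proof.
move=> tF; rewrite -Re_vnormE -[in leRHS]Re_vnormE -rmorphM lecR.
apply/ler_addgt0Pr => e e0.
have /cvgrPdist_lt/(_ e%:C) := @fourier_cvg v; rewrite ltcR => /(_ e0) near_e.
near (@summability.totally Gamma) => J.
have FJ : (F `<=` J)%fset by near: J; exact: totally_superset.
have Je : `|fourier f v - fourier_sum J v| < e%:C by near: J.
rewrite -lecR Re_vnormE rmorphD rmorphM /= Re_vnormE [leRHS]addrC.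
rewrite -(subrKA (fourier_sum J v)); apply: le_trans (ler_normD _ _) _.
by rewrite lerD ?(ltW Je) //; exact: fourier_sum_tail.
Unshelve. all: by end_near. Qed.

Lemma fourier_linear (a : R[i]) u v :
  fourier f (a *: u + v) = a *: fourier f u + fourier f v.
Proof.
apply: (cvg_unique (@norm_hausdorff _ H) (@fourier_cvg _)).
have -> : fourier_sum^~ (a *: u + v) =
    (fun J => a *: fourier_sum J u + fourier_sum J v).
  apply/funext => J; rewrite /fourier_sum scaler_sumr -big_split.
  apply: eq_bigr => g _; rewrite linearP scalerDr !scalerA.
  by rewrite (mulrC a).
by apply: cvgD; [apply: cvgZl_tmp|]; exact: fourier_cvg.
Qed.

End FourierTransform.

(** * Dimension and trace do not depend on coordinates *)

Section TraceInCoordinates.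
Variables (R : realType) (V : lmodType R[i]).

Lemma linear_mx n m (phi : 'rV[R[i]]_n -> 'rV[R[i]]_m) : linear phi ->
  exists A, forall v, phi v = v *m A.
Proof.
move=> lin.
pose L : {linear 'rV[R[i]]_n -> 'rV[R[i]]_m} :=
  HB.pack phi (GRing.isLinear.Build _ _ _ _ phi lin).
by exists (lin1_mx L) => v; rewrite mul_rV_lin1.
Qed.

Lemma coordinate_change n m (e : Vector.axiom n V) (e' : Vector.axiom m V) :
  exists A : 'M[R[i]]_(n, m), forall v, sval e' v = sval e v *m A.
Proof.
case: e e' => [e lin_e [d eK dK]] [e' lin_e' bij_e'] /=.
have [|A AE] := @linear_mx n m (e' \o d).
  move=> a u v /=; rewrite -lin_e'; congr e'.
  by apply: (can_inj eK); rewrite lin_e !dK.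
by exists A => v; rewrite -AE /= eK.
Qed.

Lemma coordinates_eq0 n m (e : Vector.axiom n V) (A B : 'M[R[i]]_(n, m)) :
  (forall v, sval e v *m A = sval e v *m B) -> A = B.
Proof.
case: e => [e lin_e [d eK dK]] /= AB; apply/row_matrixP => i.
by rewrite !rowE -(dK (delta_mx 0 i)) AB.
Qed.

Lemma coordinate_change_inverse n m (e : Vector.axiom n V) (e' : Vector.axiom m V)
    (A : 'M[R[i]]_(n, m)) (B : 'M[R[i]]_(m, n)) :
  (forall v, sval e' v = sval e v *m A) ->
  (forall v, sval e v = sval e' v *m B) -> A *m B = 1%:M.
Proof.
move=> AE BE; apply: (@coordinates_eq0 _ _ e) => v.
by rewrite mulmxA -AE -BE mulmx1.
Qed.

Lemma dimensionE n : Vector.axiom n V -> dimension V = n.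
Proof.
move=> e; rewrite /dimension; apply: xget_unique => [|m [e']]; first exact: inhabits.
have [A AE] := coordinate_change e e'.
have [B BE] := coordinate_change e' e.
apply/eqP; rewrite eqn_leq.
have := coordinate_change_inverse AE BE; have := coordinate_change_inverse BE AE.
by move=> /mulmx1_min -> /mulmx1_min ->.
Qed.

(** Two coordinate systems are related by rectangular matrices [P], [Q] inverse to each other, and
    cyclicity of the trace applies to [P *m A' *m Q] whatever their sizes. *)
Lemma traceE n (e : Vector.axiom n V) (T : V -> V) (A : 'M[R[i]]_n) :
  (forall v, sval e (T v) = sval e v *m A) -> trace T = \tr A.
Proof.
move=> TA; rewrite /trace; apply: xget_unique => [|_ [m [e' [A' [TA' ->]]]]].
  by exists n, e, A.
have [P PE] := coordinate_change e e'.
have [Q QE] := coordinate_change e' e.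
have PQ := coordinate_change_inverse PE QE.
have QP := coordinate_change_inverse QE PE.
have -> : A = P *m A' *m Q.
  apply: (@coordinates_eq0 _ _ e) => v.
  by rewrite !mulmxA -PE -TA' -QE TA.
by rewrite mxtrace_mulC mulmxA QP mul1mx.
Qed.

End TraceInCoordinates.

(** * Finite approximation of the normalized trace on a class *)

Section DualTrace.
Variables (R : realType) (Gamma : groupType).
Variables (n : nat) (rho : Gamma -> 'M[R[i]]_n) (irr : irr_mxrep rho).
Variable f : Gamma -> R[i].
Hypothesis fL1 : L1 f.

(** The isometry from row vectors to the space of [sigma] provides coordinates. Each of the [n]
    diagonal entries is a coordinate of the transform of a unit vector, so truncating the sum to [F]
    costs at most [eps] per entry. *)
Lemma normalized_trace_tail (sigma : unitary_rep R Gamma)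
    (F : {fset Gamma}) (eps : R) :
  sval (irr_class irr) sigma -> small_tail f F eps ->
  `|n%:R * normalized_trace f sigma - \sum_(g <- F) f g * \tr (rho g)|
    <= n%:R * eps%:C.
Proof.
move=> /intertwining_isometry[U [e UK eK] [normU Urho]] tF.
have lin_e : linear e.
  by move=> a u v; apply: (can_inj UK); rewrite linearP !eK.
have eB u v : e (u - v) = e u - e v by apply: (can_inj UK); rewrite linearB !eK.
pose ax : Vector.axiom n (rep_space sigma) := exist2 _ _ e lin_e (Bijective eK UK).
have n0 : (0 < n)%N by case: irr.
rewrite /normalized_trace (dimensionE ax) mulrA divff ?pnatr_eq0 -?lt0n // mul1r.
have [|A AE] := @linear_mx R n n (e \o @fourier R Gamma f sigma \o U).
  by move=> a u v /=; rewrite linearP fourier_linear // lin_e.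
rewrite (@traceE _ _ _ ax _ A) => [|v /=]; last by rewrite -AE /= eK.
under eq_bigr do rewrite mulr_sumr.
rewrite exchange_big -sumrB; apply: le_trans (ler_norm_sum _ _ _) _.
have -> : n%:R * eps%:C = \sum_(i < n) eps%:C.
  by rewrite sumr_const card_ord mulr_natl.
apply: ler_sum => i _.
pose d : l2 R n := delta_mx 0 i.
have Aii : A i i = (e (fourier f (U d))) 0 i.
  by have := AE d; rewrite /= => ->; rewrite -rowE mxE.
have Sii : \sum_(g <- F) f g * rho g i i = (e (fourier_sum f F (U d))) 0 i.
  have -> : fourier_sum f F (U d) = U (\sum_(g <- F) f g *: (d *m rho g)).
    rewrite linear_sum; apply: eq_bigr => g _.
    by rewrite linearZ Urho.
  rewrite UK summxE; apply: eq_bigr => g _.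
  by rewrite mxE -rowE mxE.
rewrite Aii Sii.
have -> : e (fourier f (U d)) 0 i - e (fourier_sum f F (U d)) 0 i =
    (e (fourier f (U d) - fourier_sum f F (U d)) : l2 R n) 0 i.
  by rewrite eB !mxE.
apply: le_trans (l2_coord_le _ i) _; rewrite -normU eK.
apply: le_trans (fourier_tail fL1 _ tF) _.
by rewrite normU l2_norm_delta mulr1.
Qed.

(** The estimate holds for every member of the class, hence for the one that [xget] selects; the
    class contains [rep_of_mxrep], so the default value does not occur. *)
Lemma dual_trace_tail (F : {fset Gamma}) (eps : R) : small_tail f F eps ->
  `|n%:R * dual_trace f (irr_class irr) - \sum_(g <- F) f g * \tr (rho g)|
    <= n%:R * eps%:C.
Proof.
move=> tF; rewrite /dual_trace; case: xgetP => [_ _ [sigma cs ->]|ne].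
  exact: normalized_trace_tail.
pose pi := rep_of_mxrep (let: And3 P _ _ := irr in P).
exfalso; apply: (ne (normalized_trace f pi)).
by exists pi => //; exact: unitary_equiv_refl.
Qed.

End DualTrace.

(** * Positive functionals and integration against their measures *)

Section PositiveFunctionals.
Variables (R : realType) (X : Type) (D : X -> Prop).
Implicit Types (phi psi : X -> R) (L : (X -> R) -> R) (A B : X -> Prop).

Definition bounded_on phi : Prop := exists C, forall x, D x -> `|phi x| <= C.

(** Positivity is tested on [D] alone, so the value of [L] at a bounded function depends only on its
    restriction to [D] ([functional_eq]), and the resulting measure is carried by [D]. *)
Definition positive_functional L : Prop :=
  (forall a phi psi, bounded_on phi -> bounded_on psi ->
     L (fun x => a * phi x + psi x) = a * L phi + L psi) /\
  (forall phi, bounded_on phi -> (forall x, D x -> 0 <= phi x) -> 0 <= L phi).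

Definition indicator A : X -> R := fun x => if `[< A x >] then 1 else 0.

Lemma bounded_on_cst c : bounded_on (fun=> c).
Proof. by exists `|c|. Qed.

Lemma bounded_on_indicator A : bounded_on (indicator A).
Proof.
by exists 1 => x _; rewrite /indicator; case: ifP; rewrite ?normr1 ?normr0 ?ler01.
Qed.

Lemma bounded_on_lin a phi psi : bounded_on phi -> bounded_on psi ->
  bounded_on (fun x => a * phi x + psi x).
Proof.
move=> [B phiB] [C psiC]; exists (`|a| * B + C) => x Dx.
apply: le_trans (ler_normD _ _) _; rewrite normrM lerD ?psiC //.
by rewrite ler_wpM2l // phiB.
Qed.

Lemma bounded_on_simple phi : fa_simple phi -> bounded_on phi.
Proof.
move=> /finite_seqP[s sE].
exists (\sum_(z <- s) `|z|) => x _.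
have : [set z | exists x, phi x = z] (phi x) by exists x.
rewrite sE /= => xs; rewrite (big_rem _ xs) /= lerDl.
by apply: sumr_ge0.
Qed.

Section Functional.
Variable L : (X -> R) -> R.
Hypothesis Lpos : positive_functional L.

Lemma functionalD phi psi : bounded_on phi -> bounded_on psi ->
  L (fun x => phi x + psi x) = L phi + L psi.
Proof.
move=> bphi bpsi; rewrite -[L phi]mul1r; case: Lpos => <- // _.
by congr L; apply/funext => x; rewrite mul1r.
Qed.

Lemma functional0 : L (fun=> 0) = 0.
Proof.
have b0 := bounded_on_cst 0; have := functionalD b0 b0.
under [X in L X]eq_fun do rewrite addr0.
by move=> /eqP; rewrite -subr_eq subrr eq_sym => /eqP.
Qed.

Lemma functionalZ a phi : bounded_on phi -> L (fun x => a * phi x) = a * L phi.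
Proof.
move=> bphi; rewrite -[RHS]addr0 -functional0; case: Lpos => <- //;
  last exact: bounded_on_cst.
by move=> _; congr L; apply/funext => x; rewrite addr0.
Qed.

Lemma functional_sum (I : eqType) (r : seq I) (phi : I -> X -> R) :
  (forall i, bounded_on (phi i)) ->
  L (fun x => \sum_(i <- r) phi i x) = \sum_(i <- r) L (phi i).
Proof.
move=> bphi.
suff [_ //] : bounded_on (fun x => \sum_(i <- r) phi i x) /\
  L (fun x => \sum_(i <- r) phi i x) = \sum_(i <- r) L (phi i).
elim: r => [|i r [bIH IH]].
  under eq_fun do rewrite big_nil.
  by rewrite big_nil functional0; split=> //; exact: bounded_on_cst.
under eq_fun do rewrite big_cons.
split; last by rewrite functionalD // IH big_cons.
have := bounded_on_lin 1 (bphi i) bIH.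
by congr bounded_on; apply/funext => x; rewrite mul1r.
Qed.

Lemma functional_le phi psi : bounded_on phi -> bounded_on psi ->
  (forall x, D x -> phi x <= psi x) -> L phi <= L psi.
Proof.
move=> bphi bpsi le_phi; rewrite -subr_ge0 addrC -mulN1r.
case: Lpos => <- // Lge0; apply: Lge0 => [|x Dx]; first exact: bounded_on_lin.
by rewrite mulN1r addrC subr_ge0 le_phi.
Qed.

Lemma functional_eq phi psi : bounded_on phi -> bounded_on psi ->
  (forall x, D x -> phi x = psi x) -> L phi = L psi.
Proof.
move=> bphi bpsi eq_phi; apply/eqP.
by rewrite eq_le !functional_le // => x /eq_phi ->.
Qed.

Definition functional_measure A : \bar R := (L (indicator A))%:E.
Local Notation mu := functional_measure.

Lemma functional_measure_additive : finitely_additive_measure mu.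
Proof.
split=> [|A|A B dAB].
- rewrite /mu -[X in _ = X]/(0%:E) -[in RHS]functional0; congr (L _)%:E.
  by apply/funext => x; rewrite /indicator asboolF.
- rewrite lee_fin; case: Lpos => _; apply; first exact: bounded_on_indicator.
  by move=> x _; rewrite /indicator; case: ifP.
- rewrite /mu -EFinD -functionalD; [|exact: bounded_on_indicator..].
  congr (L _)%:E; apply/funext => x; rewrite /indicator.
  have := dAB x; case: (asboolP (A x)) => a; case: (asboolP (B x)) => b nab.
  + by have [] := nab.
  + by rewrite asboolT ?addr0 //; left.
  + by rewrite asboolT ?add0r //; right.
  + by rewrite asboolF ?addr0 // => -[].
Qed.

Lemma functional_measure_null A : (forall x, D x -> ~ A x) -> mu A = 0%E.
Proof.
move=> DA; rewrite /mu -[RHS]/(0%:E) -functional0; congr _%:E.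
apply: functional_eq; [exact: bounded_on_indicator|exact: bounded_on_cst|].
by move=> x /DA nA; rewrite /indicator asboolF.
Qed.

(** A simple function is the finite combination of the indicators of its level sets; values outside
    its range contribute empty level sets. *)
Lemma fa_sintegral_functional s : fa_simple s -> fa_sintegral mu s = (L s)%:E.
Proof.
move=> simple_s; have [r rE] : exists r : {fset R},
    [set z | exists x, s x = z] = [set` r].
  exact/finite_fsetP.
have rP x : s x \in r.
  have : [set z | exists x, s x = z] (s x) by exists x.
  by rewrite rE.
rewrite /fa_sintegral (@fsbigTE _ _ _ _ r) => [|z zr]; last first.
  rewrite functional_measure_null ?mule0 // => x _ sxz.
  by move: zr; rewrite -sxz rP.
have bz z : bounded_on (fun x => z * indicator (fun x => s x = z) x).
  have := bounded_on_lin z (bounded_on_indicator (fun x => s x = z))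
    (bounded_on_cst 0).
  by congr bounded_on; apply/funext => x; rewrite addr0.
rewrite [in RHS](_ : s = fun x => \sum_(z <- r) z * indicator (fun x => s x = z) x).
  rewrite functional_sum // -sumEFin; apply: eq_bigr => z _.
  by rewrite functionalZ ?EFinM //; exact: bounded_on_indicator.
apply/funext => x; rewrite (big_rem _ (rP x)) /= big_seq big1 => [|z].
  by rewrite /indicator asboolT // mulr1 addr0.
rewrite mem_rem_uniq ?fset_uniq // inE => /andP[/eqP zs _].
by rewrite /indicator asboolF ?mulr0 // => /esym.
Qed.

Hypothesis LC1 : L (fun=> 1) = 1.

(** On [D] the value of [g] is rounded down to a multiple of [eps], and boundedness leaves finitely
    many values. Outside [D], where [g] may be unbounded, the approximation is 0. *)
Lemma simple_approximation (g : X -> R) (eps : R) :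
  (forall x, 0 <= g x) -> bounded_on g -> 0 < eps ->
  exists s, [/\ fa_simple s, forall x, 0 <= s x <= g x
    & forall x, D x -> g x <= s x + eps].
Proof.
move=> g0 [C gC] eps0.
have floorP x : (Num.truncn (g x / eps))%:R * eps <= g x <
      (Num.truncn (g x / eps)).+1%:R * eps.
  have : 0 <= g x / eps by rewrite divr_ge0 // ltW.
  move=> /Num.Theory.truncn_itv.
  by rewrite ler_pdivlMr // ltr_pdivrMr.
exists (fun x => if `[< D x >] then (Num.truncn (g x / eps))%:R * eps else 0); split.
- pose r := 0 :: [seq k%:R * eps | k <- iota 0 (Num.truncn (C / eps)).+1].
  apply: (@sub_finite_set _ _ [set` r]); last exact: finite_seq.
  move=> _ [x <-]; rewrite /= /r; case: asboolP => Dx; last by rewrite mem_head.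
  rewrite inE; apply/orP; right; apply/mapP; exists (Num.truncn (g x / eps)) => //.
  rewrite mem_iota add0n ltnS /=; apply: Num.Theory.le_truncn.
  rewrite ler_pM2r ?invr_gt0 //; apply: le_trans (gC _ Dx).
  exact: ler_norm.
- move=> x; case: ifP => _; last by rewrite lexx g0.
  by have /andP[-> _] := floorP x; rewrite mulr_ge0 // ltW.
- move=> x Dx; rewrite asboolT //.
  by have /andP[_ /ltW] := floorP x; rewrite -natr1 mulrDl mul1r.
Qed.

(** Simple minorants have integral at most [L g] by monotonicity; one within [eps] of [g] on [D]
    loses at most [eps], because [L] has total mass 1. *)
Lemma fa_nnintegral_functional (g : X -> R) :
  (forall x, 0 <= g x) -> bounded_on g -> fa_nnintegral mu g = (L g)%:E.
Proof.
move=> g0 bg; apply/eqP; rewrite eq_le; apply/andP; split.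
  apply: ge_ereal_sup => _ [s [simple_s sg ->]].
  rewrite fa_sintegral_functional // lee_fin; apply: functional_le => //.
    exact: bounded_on_simple.
  by move=> x _; have /andP[] := sg x.
apply/lee_addgt0Pr => eps eps0.
have [s [simple_s sg gs]] := simple_approximation g0 bg eps0.
have bs := bounded_on_simple simple_s; have beps := bounded_on_cst eps.
apply: (@le_trans _ _ ((L s)%:E + eps%:E)%E).
  rewrite -EFinD lee_fin.
  have -> : eps = L (fun=> eps).
    transitivity (L (fun=> eps * 1)); last by rewrite mulr1.
    by rewrite functionalZ ?LC1 ?mulr1 //; exact: bounded_on_cst.
  rewrite -functionalD //; apply: functional_le => //.
  have := bounded_on_lin 1 bs beps.
  by congr bounded_on; apply/funext => x; rewrite mul1r.
rewrite leeD2r //; apply: ereal_sup_ubound; exists s.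
by split=> //; rewrite fa_sintegral_functional.
Qed.

Variable E : X -> Prop.
Hypothesis DE : forall x, D x -> E x.

Lemma bounded_on_le phi psi : bounded_on psi ->
  (forall x, D x -> `|phi x| <= `|psi x|) -> bounded_on phi.
Proof.
by move=> [C psiC] le_phi; exists C => x Dx;
  exact: le_trans (le_phi x Dx) (psiC x Dx).
Qed.

Lemma fa_restrictE phi x : D x -> fa_restrict E phi x = phi x.
Proof. by move=> /DE Ex; rewrite /fa_restrict asboolT. Qed.

(** Restricting to [E] changes nothing on [D], where the positive part is the sum of [phi] and the
    negative part. *)
Lemma fa_Rintegral_functional phi : bounded_on phi ->
  fa_Rintegral mu E phi = L phi.
Proof.
move=> bphi; pose p : X -> R := (fa_restrict E phi)^\+%R.
pose q : X -> R := (fa_restrict E phi)^\-%R.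
have p0 x : 0 <= p x by rewrite /p /funrpos le_max lexx orbT.
have q0 x : 0 <= q x by rewrite /q /funrneg le_max lexx orbT.
have pE x : D x -> p x = Num.max (phi x) 0
  by rewrite /p /funrpos => /fa_restrictE ->.
have qE x : D x -> q x = Num.max (- phi x) 0
  by rewrite /q /funrneg => /fa_restrictE ->.
have bp : bounded_on p.
  apply: (bounded_on_le bphi) => x Dx; rewrite ger0_norm // pE //.
  by rewrite ge_max normr_ge0 ler_norm.
have bq : bounded_on q.
  apply: (bounded_on_le bphi) => x Dx; rewrite ger0_norm // qE //.
  by rewrite ge_max normr_ge0 -normrN ler_norm.
rewrite /fa_Rintegral !fa_nnintegral_functional //= -/p -/q.
apply/eqP; rewrite subr_eq addrC -functionalD //; apply/eqP/functional_eq => //.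
  have := bounded_on_lin 1 bq bphi.
  by congr bounded_on; apply/funext => x; rewrite mul1r.
move=> x Dx; rewrite pE // qE // /Num.max; do 2 case: ifP; lra.
Qed.

Lemma bounded_on_Re_norm (F : X -> R[i]) (psi : X -> R) :
  bounded_on (fun x => complex.Re `|F x|) ->
  (forall x, `|psi x|%:C <= `|F x|) -> bounded_on psi.
Proof.
move=> bF le_psi; apply: (bounded_on_le bF) => x _.
rewrite (ger0_norm (Re_norm_ge0 _)) -lecR Re_normE.
exact: le_psi.
Qed.

Lemma fa_integral_functional (F : X -> R[i]) :
  bounded_on (fun x => complex.Re `|F x|) ->
  fa_integral mu E F =
    L (fun x => complex.Re (F x)) +i* L (fun x => complex.Im (F x)).
Proof.
move=> bF; rewrite /fa_integral !fa_Rintegral_functional //.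
  by apply: bounded_on_Re_norm bF _ => x; exact: norm_Im_le.
by apply: bounded_on_Re_norm bF _ => x; exact: normc_ge_Re.
Qed.

Lemma fa_integrable_functional (F : X -> R[i]) :
  bounded_on (fun x => complex.Re `|F x|) -> fa_integrable mu (fun=> True) F.
Proof.
move=> bF; rewrite /fa_integrable.
have -> : fa_restrict (fun=> True) (fun x => complex.Re `|F x|) =
    (fun x => complex.Re `|F x|).
  by apply/funext => x; rewrite /fa_restrict asboolT.
by rewrite fa_nnintegral_functional ?ltry // => x; exact: Re_norm_ge0.
Qed.

End Functional.
End PositiveFunctionals.

(** * Ultralimits of normalized positive functionals *)

Section Ultralimits.
Variables (R : realType) (I : Type) (U : set_system I) (UU : UltraFilter U).

(** Compactness of the segment gives a cluster point. An ultrafilter contains the preimage of each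
    neighbourhood of it or of its complement, and clustering excludes the latter. *)
Lemma ultrafilter_bounded_cvg (h : I -> R) (B : R) :
  (forall i, `|h i| <= B) -> cvg (h @ U).
Proof.
move=> hB; apply/cvg_ex.
have hUB : (h @ U) `[- B, B]%classic.
  by rewrite nbhs_filterE /fmap /=; apply: filterE => i /=;
    rewrite in_itv /= -ler_norml.
have [l [_ clust_l]] := @segment_compact R (- B) B (h @ U) _ hUB.
exists l => A Al.
have [//|UnA] := @in_ultra_setVsetC _ U (h @^-1` A) UU.
by have [x []] := clust_l (~` A) A UnA Al.
Qed.

Variables (X : Type) (D : X -> Prop) (E : I -> (X -> R) -> R).
Hypothesis Epos : forall i, positive_functional D (E i).
Hypothesis E1 : forall i, E i (fun=> 1) = 1.

Definition ultralimit (phi : X -> R) : R := lim (E^~ phi @ U).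

Lemma functional_norm_le (phi : X -> R) (B : R) i :
  (forall x, D x -> `|phi x| <= B) -> `|E i phi| <= B.
Proof.
move=> phiB; have bphi : bounded_on D phi by exists B.
have EB b : E i (fun=> b) = b.
  have -> : (fun=> b) = (fun x : X => b * 1) by apply/funext => x; rewrite mulr1.
  rewrite (functionalZ (Epos i)) ?E1 ?mulr1 //; exact: bounded_on_cst.
rewrite ler_norml -{1}(EB (- B)) -{2}(EB B).
apply/andP; split; apply: (functional_le (Epos i)) => //; try exact: bounded_on_cst.
  by move=> x /phiB; rewrite ler_norml => /andP[].
by move=> x /phiB; rewrite ler_norml => /andP[].
Qed.

Lemma ultralimit_cvg phi : bounded_on D phi -> E^~ phi @ U --> ultralimit phi.
Proof.
move=> [B phiB]; apply: (@ultrafilter_bounded_cvg _ B) => i.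
exact: functional_norm_le.
Qed.

Lemma ultralimit_positive : positive_functional D ultralimit.
Proof.
split=> [a phi psi bphi bpsi|phi bphi phi0].
  apply/cvg_lim => //.
  have -> : E^~ (fun x => a * phi x + psi x) = (fun i => a * E i phi + E i psi).
    by apply/funext => i; have [-> //] := Epos i.
  by apply: cvgD; [apply: cvgMl_tmp|]; exact: ultralimit_cvg.
apply: limr_ge; first by apply/cvg_ex; eexists; exact: ultralimit_cvg bphi.
by apply: filterE => i; have [_] := Epos i; apply.
Qed.

Lemma ultralimit1 : ultralimit (fun=> 1) = 1.
Proof.
apply/cvg_lim => //; have -> : E^~ (fun=> 1) = (fun=> 1) by apply/funext.
exact: cvg_cst.
Qed.

Lemma ultralimit_near phi (a : R) :
  (forall eps, 0 < eps -> \forall i \near U, `|E i phi - a| <= eps) ->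
  ultralimit phi = a.
Proof.
move=> near_a; apply/cvg_lim => //; apply/cvgrPdist_le => eps /near_a.
by apply: filterS => i; rewrite distrC.
Qed.

End Ultralimits.

(** * Functionals on the dual attached to finite-dimensional representations *)

Section TraceFunctionals.
Variables (R : realType) (Gamma : groupType).
Local Notation dual := (unitary_dual R Gamma).

(** The common carrier of all functionals below; by [irr_class_fin] it consists of
    finite-dimensional classes. *)
Definition mxrep_class (c : dual) : Prop :=
  exists n (rho : Gamma -> 'M[R[i]]_n) (irr : irr_mxrep rho), c = irr_class irr.

Definition complex_functional (L : (dual -> R) -> R) (F : dual -> R[i]) : R[i] :=
  L (fun c => complex.Re (F c)) +i* L (fun c => complex.Im (F c)).

Lemma mxrep_trace_le n (rho : Gamma -> 'M[R[i]]_n) g :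
  unitary_mxrep rho -> `|\tr (rho g)| <= n%:R.
Proof.
move=> rhoP; apply: le_trans (ler_norm_sum _ _ _) _.
have -> : (n%:R : R[i]) = \sum_(i < n) 1 by rewrite sumr_const card_ord.
apply: ler_sum => i _.
pose d : l2 R n := delta_mx 0 i.
have -> : rho g i i = (rep_of_mxrep rhoP g d : l2 R n) 0 i by rewrite /= -rowE mxE.
apply: le_trans (l2_coord_le _ i) _.
by rewrite (rep_norm (pi := rep_of_mxrep rhoP)) l2_norm_delta.
Qed.

Lemma dual_trace_bounded (f : Gamma -> R[i]) : L1 f ->
  bounded_on mxrep_class (fun c => complex.Re `|dual_trace f c|).
Proof.
move=> fL1; have [F _ tF] := small_tail_exists fset0 fL1 ltr01.
exists (abs_sum f F + 1) => _ [n [rho [irr ->]]].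
have [rhoP n0 _] := irr.
rewrite (ger0_norm (Re_norm_ge0 _)) -lecR Re_normE.
have n0C : 0 < n%:R :> R[i] by rewrite ltr0n.
rewrite -(ler_pM2l n0C) -{1}(gtr0_norm n0C) -normrM.
rewrite -[X in `|X|](subrK (\sum_(g <- F) f g * \tr (rho g))).
apply: le_trans (ler_normD _ _) _; rewrite addrC rmorphD mulrDr lerD //.
  apply: le_trans (ler_norm_sum _ _ _) _.
  rewrite rmorph_sum mulr_sumr; apply: ler_sum => g _.
  rewrite normrM mulrC /= Re_normE ler_wpM2r //; exact: mxrep_trace_le.
exact: dual_trace_tail.
Qed.

(** The functional sums evaluations at the irreducible constituents of [rho], each weighted by its
    dimension; the weight cancels the normalization of [dual_trace] and reproduces the trace of
    [rho]. *)
Lemma trace_functional n (rho : Gamma -> 'M[R[i]]_n) :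
  (0 < n)%N -> unitary_mxrep rho ->
  exists L : (dual -> R) -> R,
    [/\ positive_functional mxrep_class L, L (fun=> 1) = n%:R
      & forall f F eps, L1 f -> small_tail f F eps ->
        `|complex_functional L (dual_trace f) - \sum_(g <- F) f g * \tr (rho g)|
          <= n%:R * eps%:C].
Proof.
(* The dimension is written as the character value [t 1], so that [P] depends on the character only
   and is additive in it. *)
pose P (t : Gamma -> R[i]) := exists L : (dual -> R) -> R,
    [/\ positive_functional mxrep_class L, (L (fun=> 1))%:C = t 1%g
      & forall f F eps, L1 f -> small_tail f F eps ->
        `|complex_functional L (dual_trace f) - \sum_(g <- F) f g * t g|
          <= t 1%g * eps%:C].
move=> n0 rhoP; have tr1 : \tr (rho 1%g) = n%:R.
  by case: rhoP => -> _ _; rewrite mxtrace1.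
suff [L [Lpos LC1 Lest]] : P (fun g => \tr (rho g)).
  exists L; split=> // [|f F eps fL1 tF]; last by rewrite -tr1; exact: Lest.
  by apply: complexI; rewrite LC1 tr1 rmorph_nat.
apply: mxrep_trace_ind n0 rhoP => 
  [m r irr|t u [L [Lpos LC1 Lest]] [M [Mpos MC1 Mest]]].
  have [rP m0 _] := irr.
  have r1 : \tr (r 1%g) = m%:R by case: rP => -> _ _; rewrite mxtrace1.
  exists (fun phi => m%:R * phi (irr_class irr)); split.
  - split=> [a phi psi _ _|phi _ phi0]; first by ring.
    by rewrite mulr_ge0 ?ler0n // phi0 //; exists m, r, irr.
  - by rewrite mulr1 r1 rmorph_nat.
  - move=> f F eps fL1 tF; rewrite r1.
    have -> : complex_functional (fun phi => m%:R * phi (irr_class irr))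
        (dual_trace f) = m%:R * dual_trace f (irr_class irr).
      rewrite /complex_functional -(rmorph_nat (real_complex R) m).
      by case: (dual_trace f _) => a b; simpc.
    exact: dual_trace_tail.
exists (fun phi => L phi + M phi); split.
- case: Lpos Mpos => [Llin Lge0] [Mlin Mge0].
  split=> [a phi psi bphi bpsi|phi bphi phi0]; first by rewrite Llin // Mlin //;
    ring.
  by rewrite addr_ge0 ?Lge0 ?Mge0.
- by rewrite rmorphD /= LC1 MC1.
- move=> f F eps fL1 tF.
  have -> : complex_functional (fun phi => L phi + M phi) (dual_trace f) =
      complex_functional L (dual_trace f) + complex_functional M (dual_trace f).
    by rewrite /complex_functional; simpc.
  under eq_bigr do rewrite mulrDr.
  rewrite big_split /= opprD addrACA mulrDl.
  by apply: le_trans (ler_normD _ _) _; rewrite lerD ?Lest ?Mest.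
Qed.

End TraceFunctionals.

(** * Functionals from finite quotients, and the measure *)

Section QuotientFunctionals.
Variables (R : realType) (Gamma : groupType).
Hypotheses (fgGamma : finitely_generated Gamma) (nilGamma : nilpotent_group Gamma).

Lemma finite_quotient_separating (s : seq Gamma) : exists N : set Gamma,
  [/\ is_normal N, finite_mod [set: Gamma] N
    & forall g, g \in s -> g != 1%g -> ~ N g].
Proof.
elim: s => [|g s [N [nN fN Ns]]].
  exists [set: Gamma]; split=> //.
  by exists unit, (fun=> tt).
have [->|g1] := eqVneq g 1%g.
  exists N; split=> // h; rewrite inE => /predU1P[->|/Ns//].
  by rewrite eqxx.
have [M [nM Mg fM]] := nilpotent_residually_finite fgGamma nilGamma g1.
exists (N `&` M); split=> [||h]; first exact: is_normalI.
  exact: finite_modI.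
by rewrite inE => /predU1P[->|hs] h1 [Nh Mh] //; exact: (Ns h).
Qed.

(* [E] averages over the irreducible constituents of the representation on
   [Gamma / N], whose normalized character is the indicator of [N]. *)
Lemma quotient_functional (S : {fset Gamma}) :
  exists E : (unitary_dual R Gamma -> R) -> R,
    [/\ positive_functional (@mxrep_class R Gamma) E, E (fun=> 1) = 1
      & forall f F eps, L1 f -> small_tail f F eps -> 1%g \in F -> (F `<=` S)%fset ->
        `|complex_functional E (dual_trace f) - f 1%g| <= eps%:C].
Proof.
have [N [nN fN NS]] := finite_quotient_separating S.
have [n [rho [n0 rhoP trN]]] := coset_mxrep R[i] nN fN.
have [L [[Llin Lge0] LC1 Lest]] := trace_functional n0 rhoP.
have n0R : 0 < n%:R :> R by rewrite ltr0n.
exists (fun phi => n%:R^-1 * L phi); split.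
- split=> [a phi psi bphi bpsi|phi bphi phi0]; first by rewrite Llin //; ring.
  by rewrite mulr_ge0 ?invr_ge0 ?ler0n // Lge0.
- by rewrite LC1 mulVf // gt_eqF.
move=> f F eps fL1 tF F1 FS; have := Lest f F eps fL1 tF.
(* [N] meets [S] at most in the identity, so the other elements of [F] have trace 0 and the sum
   reduces to [n * f 1]. *)
rewrite (bigD1_seq 1%g) ?fset_uniq //= big_seq_cond big1 => [|g /andP[gF g1]];
  last first.
  by rewrite trN asboolF ?mulr0 //; apply: NS => //; exact: (fsubsetP FS).
rewrite trN asboolT ?addr0; last exact: normal1.
set z := complex_functional L _ => Lz.
have -> : complex_functional (fun phi => n%:R^-1 * L phi) (dual_trace f) =
    n%:R^-1 * z.
  rewrite /z /complex_functional -(rmorph_nat (real_complex R) n) -fmorphV /=.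
  by simpc.
have n0C : 0 < n%:R :> R[i] by rewrite ltr0n.
rewrite -(ler_pM2l n0C) -{1}(gtr0_norm n0C) -normrM mulrBr mulrA divff ?gt_eqF //.
by rewrite mul1r (mulrC _ (f _)).
Qed.

End QuotientFunctionals.

Theorem theorem1p1 (R : realType) (Gamma : groupType)
  (fgGamma : finitely_generated Gamma)
  (tfGamma : torsion_free Gamma)
  (nilGamma : nilpotent_group Gamma) :
  exists mu : (unitary_dual R Gamma -> Prop) -> \bar R,
    [/\ finitely_additive_measure mu,
        mu (fun c => ~ unitary_dual_fin c) = 0%E
      & forall f : Gamma -> R[i], L1 f ->
          fa_integrable mu (fun=> True) (dual_trace f) /\
          f 1%g = fa_integral mu (@unitary_dual_fin R Gamma) (dual_trace f)].
Proof.
pose quot S := cid (quotient_functional R fgGamma nilGamma S).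
pose E S := sval (quot S).
have EP S : [/\ positive_functional (@mxrep_class R Gamma) (E S), E S (fun=> 1) = 1
    & forall f F eps, L1 f -> small_tail f F eps -> 1%g \in F -> (F `<=` S)%fset ->
      `|complex_functional (E S) (dual_trace f) - f 1%g| <= eps%:C].
  exact: (svalP (quot S)).
have Epos S : positive_functional (@mxrep_class R Gamma) (E S) by case: (EP S).
have E1 S : E S (fun=> 1) = 1 by case: (EP S).
(* An ultrafilter on the finite subsets of [Gamma] containing, for each finite [F], the set of all
   finite [S] that include [F]. *)
have [U [UU totU]] := ultraFilterLemma (@summability.totally_filter Gamma).
have Lpos := ultralimit_positive UU Epos E1.
have LC1 := ultralimit1 UU E1.
set L := ultralimit U E in Lpos LC1.
have class_fin c : mxrep_class c -> @unitary_dual_fin R Gamma c.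
  by move=> [n [rho [irr ->]]]; exact: irr_class_fin.
exists (functional_measure L); split.
- exact: functional_measure_additive Lpos.
- by apply: (functional_measure_null Lpos) => c /class_fin fin_c; apply.
move=> f fL1; have bf := dual_trace_bounded fL1.
split; first exact: (fa_integrable_functional Lpos LC1 bf).
rewrite (fa_integral_functional Lpos LC1 class_fin bf).
have near_f eps : 0 < eps ->
    \forall S \near U, `|complex_functional (E S) (dual_trace f) - f 1%g| <= eps%:C.
  (* With [F] containing the identity and leaving a tail of at most [eps], the estimate holds for
     every [S] including [F], hence [U]-almost everywhere. *)
  move=> eps0; have [F F1 tF] := small_tail_exists [fset 1%g]%fset fL1 eps0.
  apply: totU; exists F => // S /= FS; have [_ _] := EP S.
  by apply; [exact: fL1|exact: tF|rewrite (fsubsetP F1) // inE|exact: FS].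
suff [-> ->] : L (fun c => complex.Re (dual_trace f c)) = complex.Re (f 1%g) /\
    L (fun c => complex.Im (dual_trace f c)) = complex.Im (f 1%g) by case: (f 1%g).
split; apply: (ultralimit_near UU) => eps /near_f; apply: filterS => S Sle;
    rewrite -lecR; apply: le_trans Sle.
- by apply: le_trans (normc_ge_Re _); rewrite lecR raddfB.
- by apply: le_trans (norm_Im_le _); rewrite lecR raddfB.
Qed.
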